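(* Let $\alpha\in\mathcal C$ be a $W$-orbit in $X(D)$ and let $f\colon A\to k$ be a specialization. Then the pair of functors $({}_fF_\alpha,{}_fG_\alpha)$, where \[ {}_fF_\alpha\colon {}_f\mathcal H_\alpha\text{-mod}\to {}_f\mathcal O_\alpha ,\qquad {}_fG_\alpha\colon {}_f\mathcal O_\alpha\to {}_f\mathcal H_\alpha\text{-mod}, \] is an adjoint equivalence of categories. In particular, the block ${}_f\mathcal O_\alpha$ of ${}_f\mathcal H$ is naturally equivalent to the category of left ${}_f\mathcal H_\alpha$-modules.
   Context: Let $n,b$ be positive integers, let $\mathbf q,\mathbf a$ be indeterminates, and write $[l]=\{1,\dots,l\}$. Let $\mathcal H_{b,n}$ be the unital associative $\mathbb Z[\mathbf q,\mathbf a]$-algebra with generators $T_1,\dots,T_n,R_1,\dots,R_{n-1}$ and relations: $T_j^b=1$ ($j\in[n]$); $T_jT_{j'}=T_{j'}T_j$ ($j,j'\in[n]$); $T_jR_i=R_iT_{s_i(j)}$ ($j\in[n]$, $i\in[n-1]$); $R_iR_{i'}=R_{i'}R_i$ ($|i-i'|>1$); $R_iR_{i+1}R_i=R_{i+1}R_iR_{i+1}$ ($i\in[n-2]$); $R_i^2=\mathbf q+\mathbf a\,T_i^{(b^2-b)/2}E_iR_i$ ($i\in[n-1]$), where $s_i=(i\ i{+}1)$ and $E_i=\sum_{k=0}^{b-1}T_i^kT_{i+1}^{-k}$. Let $\zeta\in\mathbb C$ be a primitive $b$th root of unity. $A$ is the smallest subring of an algebraic closure of $\mathbb C(\mathbf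 q,\mathbf a)$ that contains $1,\mathbf q,\mathbf a,\zeta$ and a fixed square root $\sqrt{b^2\mathbf a^2+4\mathbf q}$, in which $2$, $b$, $\mathbf q$ are units, and in which $1+x+\dots+x^k$ is a unit for every $k\in[n-2]$, where $x=\dfrac{b^2\mathbf a^2+b\mathbf a\sqrt{b^2\mathbf a^2+4\mathbf q}+2\mathbf q}{2\mathbf q}$. Put $\mathcal H=A\otimes_{\mathbb Z[\mathbf q,\mathbf a]}\mathcal H_{b,n}$. $D$ is the group of diagonal matrices in $\mathrm{GL}_n(\mathbb C)$ with diagonal entries in $\langle\zeta\rangle$; for $d=\mathrm{diag}(\zeta^{p_1},\dots,\zeta^{p_n})\in D$ put $t_d=T_1^{p_1}\cdots T_n^{p_n}$. $W$ is the group of permutation matrices in $\mathrm{GL}_n(\mathbb C)$. $X(D)$ is the group of group homomorphisms $\chi\colon D\to A^\times$; $W$ acts on $X(D)$ by $(w\cdot\chi)(d)=\chi(w^{-1}dw)$. $\mathcal C$ is the set of $W$-orbits in $X(D)$, and for each $\alpha\in\mathcal C$ a representative $\chi_\alpha\in\alpha$ is fixed. For $\chi\in X(D)$ put $e_\chi=b^{-n}\sum_{d\in D}\chi(d^{-1})t_d$, an idempotent of $\mathcal H$. For $\alpha\in\mathcal C$ put $e_\alpha=\sum_{\chi\in\alpha}e_\chi$, a central idempotent of $\mathcal H$, and $\mathcal H_\alpha=e_{\chi_\alpha}\mathcal He_{\chi_\alpha}$, an algebra with identity $e_{\chi_\alpha}$. A specialization is a ring homomorphism $f\colon A\to k$ with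 $k$ a commutative ring with identity and $f(1)=1$; put ${}_f\mathcal H=k\otimes_A\mathcal H$ and ${}_f\mathcal H_\alpha=k\otimes_A\mathcal H_\alpha=e_{\chi_\alpha}\,{}_f\mathcal H\,e_{\chi_\alpha}$, where $1\otimes e_\chi$ and $1\otimes e_\alpha$ are again denoted $e_\chi$ and $e_\alpha$. For a ring $R$, $R$-mod is the category of left $R$-modules. The block ${}_f\mathcal O_\alpha$ is the full subcategory of ${}_f\mathcal H$-mod whose objects are the modules $V$ with $V=e_\alpha V$. The functor ${}_fG_\alpha$ is given by ${}_fG_\alpha(V)=e_{\chi_\alpha}V$ on objects and by restriction on morphisms. The functor ${}_fF_\alpha$ is given by ${}_fF_\alpha(V')={}_f\mathcal H\,e_{\chi_\alpha}\otimes_{{}_f\mathcal H_\alpha}V'$ on objects and by $\psi\mapsto\mathrm{id}\otimes\psi$ on morphisms. *)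

(* Defs.v *)
From HB Require Import structures.
From mathcomp Require Import all_boot all_order all_fingroup all_algebra.
From mathcomp Require Import generic_quotient fraction complex.
From mathcomp Require Import finmap boolp classical_sets cardinality fsbigop reals.

Set Implicit Arguments.
Unset Strict Implicit.
Unset Printing Implicit Defensive.

Import Order.TTheory GRing.Theory Num.Theory.
Local Open Scope ring_scope.
Local Open Scope quotient_scope.

(* Unital algebras over a commutative ring.  The library's [algType] demands a
   nonzero ring, whereas base change may produce the zero ring. *)
Record pzAlgebra (K : comPzRingType) := PzAlgebra {
  alg_ring :> pzRingType;
  alg_map : {rmorphism K -> alg_ring};
  alg_map_central : forall c (x : alg_ring), alg_map c * x = x * alg_map c
}.

Section PresentedAlgebra.
Variables (K : comPzRingType) (G : Type).

Inductive term : Type :=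
| Const of K
| Gen of G
| Add of term & term
| Mul of term & term.

HB.instance Definition _ := gen_eqMixin term.
HB.instance Definition _ := gen_choiceMixin term.

Fixpoint Exp (t : term) (m : nat) : term :=
  if m is m'.+1 then Mul t (Exp t m') else Const 1.

Definition Sum (s : seq term) : term := foldr Add (Const 0) s.

Variable rel : term -> term -> Prop.

(* The smallest congruence containing [rel] and the axioms of unital
   associative [K]-algebras. *)
Inductive pres_eq : term -> term -> Prop :=
| pres_rel t u of rel t u : pres_eq t u
| pres_refl t : pres_eq t t
| pres_sym t u of pres_eq t u : pres_eq u t
| pres_trans t u v of pres_eq t u & pres_eq u v : pres_eq t v
| pres_add t t' u u' of pres_eq t t' & pres_eq u u' :
    pres_eq (Add t u) (Add t' u')
| pres_mul t t' u u' of pres_eq t t' & pres_eq u u' :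
    pres_eq (Mul t u) (Mul t' u')
| pres_addA t u v : pres_eq (Add t (Add u v)) (Add (Add t u) v)
| pres_addC t u : pres_eq (Add t u) (Add u t)
| pres_add0 t : pres_eq (Add (Const 0) t) t
| pres_addN t : pres_eq (Add (Mul (Const (- 1)) t) t) (Const 0)
| pres_mulA t u v : pres_eq (Mul t (Mul u v)) (Mul (Mul t u) v)
| pres_mul1 t : pres_eq (Mul (Const 1) t) t
| pres_mulDl t u v : pres_eq (Mul (Add t u) v) (Add (Mul t v) (Mul u v))
| pres_mulDr t u v : pres_eq (Mul t (Add u v)) (Add (Mul t u) (Mul t v))
| pres_constD c d : pres_eq (Const (c + d)) (Add (Const c) (Const d))
| pres_constM c d : pres_eq (Const (c * d)) (Mul (Const c) (Const d))
| pres_constC c t : pres_eq (Mul (Const c) t) (Mul t (Const c)).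

Definition pres_eqb (t u : term) : bool := `[< pres_eq t u >].

Lemma pres_eqb_refl : reflexive pres_eqb.
Proof. by move=> t; apply/asboolP; exact: pres_refl. Qed.

Lemma pres_eqb_sym : symmetric pres_eqb.
Proof. by move=> t u; apply/asboolP/asboolP; exact: pres_sym. Qed.

Lemma pres_eqb_trans : transitive pres_eqb.
Proof.
move=> u t v /asboolP tu /asboolP uv; apply/asboolP; exact: pres_trans uv.
Qed.

Canonical pres_equiv : equiv_rel term :=
  EquivRel pres_eqb pres_eqb_refl pres_eqb_sym pres_eqb_trans.

Definition pres_quot : Type := {eq_quot pres_equiv}.

HB.instance Definition _ := Choice.on pres_quot.

Definition pcl (t : term) : pres_quot := \pi_{eq_quot pres_equiv} t.
Definition prep (x : pres_quot) : term := repr (x : {eq_quot pres_equiv}).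

Lemma pcl_eq t u : pcl t = pcl u <-> pres_eq t u.
Proof.
split; first by move/eqmodP/asboolP.
by move=> tu; apply/eqmodP/asboolP.
Qed.

Lemma prepK x : pcl (prep x) = x.
Proof. by rewrite /pcl /prep reprK. Qed.

Lemma prep_pcl t : pres_eq (prep (pcl t)) t.
Proof. by apply/pcl_eq; rewrite prepK. Qed.

Definition pres_zero : pres_quot := pcl (Const 0).
Definition pres_one : pres_quot := pcl (Const 1).
Definition pres_addop (x y : pres_quot) := pcl (Add (prep x) (prep y)).
Definition pres_mulop (x y : pres_quot) := pcl (Mul (prep x) (prep y)).
Definition pres_opp (x : pres_quot) := pcl (Mul (Const (- 1)) (prep x)).

Lemma pclD t u : pcl (Add t u) = pres_addop (pcl t) (pcl u).
Proof. by apply/pcl_eq/pres_sym/pres_add; exact: prep_pcl. Qed.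

Lemma pclM t u : pcl (Mul t u) = pres_mulop (pcl t) (pcl u).
Proof. by apply/pcl_eq/pres_sym/pres_mul; exact: prep_pcl. Qed.

Lemma pclN t : pcl (Mul (Const (- 1)) t) = pres_opp (pcl t).
Proof. by apply/pcl_eq/pres_sym/pres_mul; [exact: pres_refl|exact: prep_pcl]. Qed.

Lemma pres_addopA : associative pres_addop.
Proof.
move=> x y z; rewrite -(prepK x) -(prepK y) -(prepK z) -!pclD.
exact/pcl_eq/pres_addA.
Qed.

Lemma pres_addopC : commutative pres_addop.
Proof.
by move=> x y; rewrite -(prepK x) -(prepK y) -!pclD; exact/pcl_eq/pres_addC.
Qed.

Lemma pres_add0op : left_id pres_zero pres_addop.
Proof. by move=> x; rewrite -(prepK x) -!pclD; exact/pcl_eq/pres_add0. Qed.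

Lemma pres_addNop : left_inverse pres_zero pres_opp pres_addop.
Proof. by move=> x; rewrite -(prepK x) -pclN -pclD; exact/pcl_eq/pres_addN. Qed.

HB.instance Definition _ := GRing.isZmodule.Build pres_quot
  pres_addopA pres_addopC pres_add0op pres_addNop.

Lemma pres_mulopA : associative pres_mulop.
Proof.
move=> x y z; rewrite -(prepK x) -(prepK y) -(prepK z) -!pclM.
exact/pcl_eq/pres_mulA.
Qed.

Lemma pres_mul1op : left_id pres_one pres_mulop.
Proof. by move=> x; rewrite -(prepK x) -!pclM; exact/pcl_eq/pres_mul1. Qed.

Lemma pres_mulop1 : right_id pres_one pres_mulop.
Proof.
move=> x; rewrite -(prepK x) -!pclM; apply/pcl_eq.
exact: pres_trans (pres_sym (pres_constC _ _)) (pres_mul1 _).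
Qed.

Lemma pres_mulopDl : left_distributive pres_mulop +%R.
Proof.
move=> x y z; rewrite -(prepK x) -(prepK y) -(prepK z).
by rewrite -[_ + _]pclD -!pclM -[RHS]pclD; exact/pcl_eq/pres_mulDl.
Qed.

Lemma pres_mulopDr : right_distributive pres_mulop +%R.
Proof.
move=> x y z; rewrite -(prepK x) -(prepK y) -(prepK z).
by rewrite -[pcl (prep y) + _]pclD -!pclM -[RHS]pclD; exact/pcl_eq/pres_mulDr.
Qed.

HB.instance Definition _ := GRing.Zmodule_isPzRing.Build pres_quot
  pres_mulopA pres_mul1op pres_mulop1 pres_mulopDl pres_mulopDr.

Definition pconst (c : K) : pres_quot := pcl (Const c).

Lemma pconst_is_zmod_morphism : zmod_morphism pconst.
Proof.
move=> c d; apply: (addIr (pconst d)); rewrite subrK.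
apply: etrans (esym (pclD (Const (c - d)) (Const d))) _.
by apply/pcl_eq; have := pres_constD (c - d) d; rewrite subrK => /pres_sym.
Qed.

Lemma pconst_is_monoid_morphism : monoid_morphism pconst.
Proof.
split=> // c d; apply: etrans (pclM (Const c) (Const d)).
exact/pcl_eq/pres_constM.
Qed.

HB.instance Definition _ :=
  GRing.isZmodMorphism.Build K pres_quot pconst pconst_is_zmod_morphism.
HB.instance Definition _ :=
  GRing.isMonoidMorphism.Build K pres_quot pconst pconst_is_monoid_morphism.

Lemma pconst_central c (x : pres_quot) : pconst c * x = x * pconst c.
Proof.
rewrite -(prepK x); apply: etrans (pclM (prep x) (Const c)).
by apply: etrans (esym (pclM _ _)) _; exact/pcl_eq/pres_constC.
Qed.

Definition presAlg : pzAlgebra K := PzAlgebra pconst_central.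

End PresentedAlgebra.

Arguments Const {K G}.
Arguments Gen {K G}.
Arguments pcl {K G rel}.

(* The tensor product over [S] of a right module [M] and a left module [N]: the
   abelian group generated by the pairs (m, n), subject to biadditivity and to
   (m s, n) = (m, s n).  A list of pairs stands for the sum of its entries. *)
Section Tensor.
Variables (S : Type) (M N : zmodType).
Variables (ract : M -> S -> M) (lact : S -> N -> N).

Inductive tens_eq : seq (M * N) -> seq (M * N) -> Prop :=
| tens_refl s : tens_eq s s
| tens_sym s t of tens_eq s t : tens_eq t s
| tens_trans s t u of tens_eq s t & tens_eq t u : tens_eq s u
| tens_cat s s' t t' of tens_eq s s' & tens_eq t t' :
    tens_eq (s ++ t) (s' ++ t')
| tens_catC s t : tens_eq (s ++ t) (t ++ s)
| tens_addl m m' n : tens_eq [:: (m + m', n)] [:: (m, n); (m', n)]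
| tens_addr m n n' : tens_eq [:: (m, n + n')] [:: (m, n); (m, n')]
| tens_0l n : tens_eq [:: (0, n)] [::]
| tens_bal m a n : tens_eq [:: (ract m a, n)] [:: (m, lact a n)].

Definition formal_sum : Type := seq (M * N).
HB.instance Definition _ := gen_eqMixin formal_sum.
HB.instance Definition _ := gen_choiceMixin formal_sum.

Definition tens_eqb (s t : formal_sum) : bool := `[< tens_eq s t >].

Lemma tens_eqb_refl : reflexive tens_eqb.
Proof. by move=> s; apply/asboolP; exact: tens_refl. Qed.

Lemma tens_eqb_sym : symmetric tens_eqb.
Proof. by move=> s t; apply/asboolP/asboolP; exact: tens_sym. Qed.

Lemma tens_eqb_trans : transitive tens_eqb.
Proof.
move=> t s u /asboolP st /asboolP tu; apply/asboolP; exact: tens_trans tu.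
Qed.

Canonical tens_equiv : equiv_rel formal_sum :=
  EquivRel tens_eqb tens_eqb_refl tens_eqb_sym tens_eqb_trans.

Definition tens : Type := {eq_quot tens_equiv}.

HB.instance Definition _ := Choice.on tens.

Definition tcl (s : seq (M * N)) : tens := \pi_{eq_quot tens_equiv} s.
Definition trep (x : tens) : seq (M * N) := repr (x : {eq_quot tens_equiv}).

Lemma tcl_eq s t : tcl s = tcl t <-> tens_eq s t.
Proof.
split; first by move/eqmodP/asboolP.
by move=> st; apply/eqmodP/asboolP.
Qed.

Lemma trepK x : tcl (trep x) = x.
Proof. by rewrite /tcl /trep reprK. Qed.

Lemma trep_tcl s : tens_eq (trep (tcl s)) s.
Proof. by apply/tcl_eq; rewrite trepK. Qed.

Definition tens_neg (s : seq (M * N)) := [seq (- p.1, p.2) | p <- s].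

Lemma tens_neg_add s : tens_eq (tens_neg s ++ s) [::].
Proof.
elim: s => [|[m n] s IH] /=; first exact: tens_refl.
have -> : (- m, n) :: tens_neg s ++ (m, n) :: s
    = [:: (- m, n)] ++ (tens_neg s ++ [:: (m, n)]) ++ s by rewrite -catA.
apply: tens_trans (_ : tens_eq _
  ([:: (- m, n)] ++ ([:: (m, n)] ++ tens_neg s) ++ s)) _.
  apply: tens_cat; first exact: tens_refl.
  by apply: tens_cat; [exact: tens_catC | exact: tens_refl].
rewrite -catA.
apply: (@tens_cat [:: (- m, n); (m, n)] [::] (tens_neg s ++ s) [::]);
  last exact: IH.
apply: tens_trans (tens_sym (tens_addl _ _ _)) _.
by rewrite addNr; exact: tens_0l.
Qed.

Lemma tens_neg_eq s t : tens_eq s t -> tens_eq (tens_neg s) (tens_neg t).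
Proof.
move=> st.
apply: tens_trans (_ : tens_eq _ (tens_neg s ++ (t ++ tens_neg t))) _.
  rewrite -[X in tens_eq X _]cats0; apply: tens_cat; first exact: tens_refl.
  apply: tens_sym; apply: tens_trans (tens_catC _ _) (tens_neg_add _).
rewrite catA -[X in tens_eq _ X]cat0s; apply: tens_cat; last exact: tens_refl.
apply: tens_trans (tens_neg_add s).
by apply: tens_cat; [exact: tens_refl | exact: tens_sym].
Qed.

Definition tens_addop (x y : tens) := tcl (trep x ++ trep y).
Definition tens_opp (x : tens) := tcl (tens_neg (trep x)).

Lemma tclD s t : tcl (s ++ t) = tens_addop (tcl s) (tcl t).
Proof. by apply/tcl_eq/tens_sym/tens_cat; exact: trep_tcl. Qed.

Lemma tclN s : tcl (tens_neg s) = tens_opp (tcl s).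
Proof. by apply/tcl_eq/tens_sym/tens_neg_eq; exact: trep_tcl. Qed.

Lemma tens_addopA : associative tens_addop.
Proof.
by move=> x y z; rewrite -(trepK x) -(trepK y) -(trepK z) -!tclD catA.
Qed.

Lemma tens_addopC : commutative tens_addop.
Proof.
by move=> x y; rewrite -(trepK x) -(trepK y) -!tclD; exact/tcl_eq/tens_catC.
Qed.

Lemma tens_add0op : left_id (tcl [::]) tens_addop.
Proof. by move=> x; rewrite -(trepK x) -!tclD. Qed.

Lemma tens_addNop : left_inverse (tcl [::]) tens_opp tens_addop.
Proof.
by move=> x; rewrite -(trepK x) -tclN -tclD; exact/tcl_eq/tens_neg_add.
Qed.

HB.instance Definition _ := GRing.isZmodule.Build tens
  tens_addopA tens_addopC tens_add0op tens_addNop.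

Definition pure (m : M) (n : N) : tens := tcl [:: (m, n)].

Lemma pureDl m m' n : pure (m + m') n = pure m n + pure m' n.
Proof.
apply: etrans (tclD [:: (m, n)] [:: (m', n)]); exact/tcl_eq/tens_addl.
Qed.

Lemma pureDr m n n' : pure m (n + n') = pure m n + pure m n'.
Proof.
apply: etrans (tclD [:: (m, n)] [:: (m, n')]); exact/tcl_eq/tens_addr.
Qed.

Lemma pure_bal m a n : pure (ract m a) n = pure m (lact a n).
Proof. exact/tcl_eq/tens_bal. Qed.

Lemma tens_ind (P : tens -> Prop) :
  P 0 -> (forall x y, P x -> P y -> P (x + y)) -> (forall m n, P (pure m n)) ->
  forall x, P x.
Proof.
move=> P0 PD Pp x; rewrite -(trepK x); elim: (trep x) => [//|[m n] s IH].
rewrite -cat1s tclD; apply: PD; [exact: Pp | exact: IH].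
Qed.

Section Lift.
Variables (Z : zmodType) (beta : M -> N -> Z).
Hypothesis betaDl : forall m m' n, beta (m + m') n = beta m n + beta m' n.
Hypothesis betaDr : forall m n n', beta m (n + n') = beta m n + beta m n'.
Hypothesis beta_bal : forall m a n, beta (ract m a) n = beta m (lact a n).

Definition tens_lift (x : tens) : Z := \sum_(p <- trep x) beta p.1 p.2.

Lemma tens_lift_tcl s : tens_lift (tcl s) = \sum_(p <- s) beta p.1 p.2.
Proof.
suff H t u : tens_eq t u ->
    \sum_(p <- t) beta p.1 p.2 = \sum_(p <- u) beta p.1 p.2.
  by apply: H; exact: trep_tcl.
elim => {t u} //.
- by move=> t u v _ -> _ ->.
- by move=> t t' u u' _ e1 _ e2; rewrite !big_cat /= e1 e2.
- by move=> t u; rewrite !big_cat /= addrC.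
- by move=> m m' n; rewrite !big_cons big_nil /= !addr0 betaDl.
- by move=> m n n'; rewrite !big_cons big_nil /= !addr0 betaDr.
- move=> n; rewrite big_cons !big_nil addr0 /=.
  by apply: (addrI (beta 0 n)); rewrite -betaDl !addr0.
- by move=> m a n; rewrite !big_cons !big_nil /= beta_bal.
Qed.

Lemma tens_lift_pure m n : tens_lift (pure m n) = beta m n.
Proof. by rewrite tens_lift_tcl big_seq1. Qed.

Lemma tens_liftD x y : tens_lift (x + y) = tens_lift x + tens_lift y.
Proof.
rewrite -(trepK x) -(trepK y) -[_ + _]tclD.
by rewrite !tens_lift_tcl big_cat.
Qed.

End Lift.
End Tensor.

(* The [K']-algebra K' (x)_K B obtained from a [K]-algebra [B] by base change
   along [f : K -> K']. *)
Section BaseChange.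
Variables (K K' : comPzRingType) (f : {rmorphism K -> K'}) (B : pzAlgebra K).

Definition bc_ract (a : K') (c : K) : K' := a * f c.
Definition bc_lact (c : K) (x : B) : B := alg_map B c * x.

Definition bc_quot : Type := tens bc_ract bc_lact.
HB.instance Definition _ := GRing.Zmodule.on bc_quot.

Definition bpure (a : K') (x : B) : bc_quot := pure bc_ract bc_lact a x.

Lemma bpureDl a a' x : bpure (a + a') x = bpure a x + bpure a' x.
Proof. exact: pureDl. Qed.

Lemma bpureDr a x x' : bpure a (x + x') = bpure a x + bpure a x'.
Proof. exact: pureDr. Qed.

Lemma bpure_bal a c x : bpure (a * f c) x = bpure a (alg_map B c * x).
Proof. exact: pure_bal. Qed.

Lemma bc_ind (P : bc_quot -> Prop) :
  P 0 -> (forall x y, P x -> P y -> P (x + y)) ->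
  (forall a x, P (bpure a x)) -> forall x, P x.
Proof. exact: tens_ind. Qed.

Definition bc_mulpure (a : K') (x : B) : bc_quot -> bc_quot :=
  tens_lift (fun a' x' => bpure (a * a') (x * x')).

Definition bc_mul (u v : bc_quot) : bc_quot :=
  tens_lift (fun a x => bc_mulpure a x v) u.

Lemma bc_mulpureE a x a' x' :
  bc_mulpure a x (bpure a' x') = bpure (a * a') (x * x').
Proof.
apply: tens_lift_pure => [b b' y|b y y'|b c y].
- by rewrite mulrDr bpureDl.
- by rewrite mulrDr bpureDr.
- by rewrite mulrA bpure_bal /bc_lact !mulrA alg_map_central.
Qed.

Lemma bc_mulpureDr a x u v :
  bc_mulpure a x (u + v) = bc_mulpure a x u + bc_mulpure a x v.
Proof.
apply: tens_liftD => [b b' y|b y y'|b c y].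
- by rewrite mulrDr bpureDl.
- by rewrite mulrDr bpureDr.
- by rewrite mulrA bpure_bal /bc_lact !mulrA alg_map_central.
Qed.

Lemma bc_mulpure0 a x : bc_mulpure a x 0 = 0.
Proof. by apply: (addrI (bc_mulpure a x 0)); rewrite -bc_mulpureDr !addr0. Qed.

Lemma bc_mulpureDl a a' x u :
  bc_mulpure (a + a') x u = bc_mulpure a x u + bc_mulpure a' x u.
Proof.
elim/bc_ind: u => [|u v eu ev|b y]; first by rewrite !bc_mulpure0 addr0.
  by rewrite !bc_mulpureDr eu ev addrACA.
by rewrite !bc_mulpureE mulrDl bpureDl.
Qed.

Lemma bc_mulpureDm a x x' u :
  bc_mulpure a (x + x') u = bc_mulpure a x u + bc_mulpure a x' u.
Proof.
elim/bc_ind: u => [|u v eu ev|b y]; first by rewrite !bc_mulpure0 addr0.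
  by rewrite !bc_mulpureDr eu ev addrACA.
by rewrite !bc_mulpureE mulrDl bpureDr.
Qed.

Lemma bc_mulpure_bal a c x u :
  bc_mulpure (bc_ract a c) x u = bc_mulpure a (bc_lact c x) u.
Proof.
elim/bc_ind: u => [|u v eu ev|b y]; first by rewrite !bc_mulpure0.
  by rewrite !bc_mulpureDr eu ev.
by rewrite !bc_mulpureE mulrAC bpure_bal /bc_lact mulrA.
Qed.

Lemma bc_mulE a x u : bc_mul (bpure a x) u = bc_mulpure a x u.
Proof.
apply: tens_lift_pure => *.
- exact: bc_mulpureDl.
- exact: bc_mulpureDm.
- exact: bc_mulpure_bal.
Qed.

Lemma bc_mulDl : left_distributive bc_mul +%R.
Proof.
move=> u v w; apply: tens_liftD => *.
- exact: bc_mulpureDl.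
- exact: bc_mulpureDm.
- exact: bc_mulpure_bal.
Qed.

Lemma bc_mul0l u : bc_mul 0 u = 0.
Proof. by apply: (addrI (bc_mul 0 u)); rewrite -bc_mulDl !addr0. Qed.

Lemma bc_mulDr : right_distributive bc_mul +%R.
Proof.
move=> u v w; elim/bc_ind: u => [|u u' e e'|a x].
- by rewrite !bc_mul0l addr0.
- by rewrite !bc_mulDl e e' addrACA.
- by rewrite !bc_mulE bc_mulpureDr.
Qed.

Lemma bc_mul0r u : bc_mul u 0 = 0.
Proof. by apply: (addrI (bc_mul u 0)); rewrite -bc_mulDr !addr0. Qed.

Lemma bc_mulA : associative bc_mul.
Proof.
move=> u v w; elim/bc_ind: u => [|u u' e e'|a x]; first by rewrite !bc_mul0l.
  by rewrite !bc_mulDl e e'.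
elim/bc_ind: v => [|v v' e e'|b y]; first by rewrite !(bc_mul0l, bc_mul0r).
  by rewrite !(bc_mulDl, bc_mulDr) e e'.
elim/bc_ind: w => [|w w' e e'|c z]; first by rewrite !bc_mul0r.
  by rewrite !bc_mulDr e e'.
by rewrite !(bc_mulE, bc_mulpureE) !mulrA.
Qed.

Lemma bc_mul1l : left_id (bpure 1 1) bc_mul.
Proof.
elim/bc_ind => [|u v e e'|a x]; first exact: bc_mul0r.
  by rewrite bc_mulDr e e'.
by rewrite bc_mulE bc_mulpureE !mul1r.
Qed.

Lemma bc_mul1r : right_id (bpure 1 1) bc_mul.
Proof.
elim/bc_ind => [|u v e e'|a x]; first exact: bc_mul0l.
  by rewrite bc_mulDl e e'.
by rewrite bc_mulE bc_mulpureE !mulr1.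
Qed.

HB.instance Definition _ := GRing.Zmodule_isPzRing.Build bc_quot
  bc_mulA bc_mul1l bc_mul1r bc_mulDl bc_mulDr.

Lemma bpureM a x a' x' : bpure a x * bpure a' x' = bpure (a * a') (x * x').
Proof. by rewrite [LHS]bc_mulE bc_mulpureE. Qed.

Definition bscal (a : K') : bc_quot := bpure a 1.
Definition binj (x : B) : bc_quot := bpure 1 x.

Lemma bscal_is_zmod_morphism : zmod_morphism bscal.
Proof.
by move=> a b; apply: (addIr (bscal b)); rewrite subrK -[LHS]bpureDl subrK.
Qed.

Lemma bscal_is_monoid_morphism : monoid_morphism bscal.
Proof. by split=> // a b; rewrite [RHS]bpureM mulr1. Qed.

HB.instance Definition _ :=
  GRing.isZmodMorphism.Build K' bc_quot bscal bscal_is_zmod_morphism.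
HB.instance Definition _ :=
  GRing.isMonoidMorphism.Build K' bc_quot bscal bscal_is_monoid_morphism.

Lemma binj_is_zmod_morphism : zmod_morphism binj.
Proof.
by move=> x y; apply: (addIr (binj y)); rewrite subrK -[LHS]bpureDr subrK.
Qed.

Lemma binj_is_monoid_morphism : monoid_morphism binj.
Proof. by split=> // x y; rewrite [RHS]bpureM mulr1. Qed.

HB.instance Definition _ :=
  GRing.isZmodMorphism.Build B bc_quot binj binj_is_zmod_morphism.
HB.instance Definition _ :=
  GRing.isMonoidMorphism.Build B bc_quot binj binj_is_monoid_morphism.

Lemma bscal_central a (u : bc_quot) : bscal a * u = u * bscal a.
Proof.
elim/bc_ind: u => [|u v e e'|b x]; first by rewrite mulr0 mul0r.
  by rewrite mulrDl mulrDr e e'.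
by rewrite !bpureM mulr1 mul1r mulrC.
Qed.

Definition baseChange : pzAlgebra K' := PzAlgebra bscal_central.

Definition one_tens : {rmorphism B -> baseChange} := binj.

Lemma one_tens_map c : one_tens (alg_map B c) = alg_map baseChange (f c).
Proof.
by rewrite /= -[c in LHS]mulr1 /binj -[f c]mul1r /bscal bpure_bal rmorphM rmorph1.
Qed.

Lemma baseChange_ind (P : baseChange -> Prop) :
  P 0 -> (forall x y, P x -> P y -> P (x + y)) ->
  (forall a x, P (alg_map baseChange a * one_tens x)) -> forall x, P x.
Proof.
move=> P0 PD Pp; apply: bc_ind => // a x.
by have := Pp a x; rewrite /= [_ * _]bpureM mulr1 mul1r.
Qed.

End BaseChange.

Record category := Category {
  Obj :> Type;
  Hom : Obj -> Obj -> Type;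
  idm : forall X, Hom X X;
  compm : forall X Y Z, Hom Y Z -> Hom X Y -> Hom X Z;
  compmA : forall X Y Z W (h : Hom Z W) (g : Hom Y Z) (f : Hom X Y),
    compm h (compm g f) = compm (compm h g) f;
  comp1m : forall X Y (f : Hom X Y), compm (idm Y) f = f;
  compm1 : forall X Y (f : Hom X Y), compm f (idm X) = f
}.
Arguments Hom {_} X Y.
Arguments idm {_} X.
Arguments compm {_ X Y Z} _ _.

Record functor (C D : category) := Functor {
  fobj :> C -> D;
  fmap : forall X Y, Hom X Y -> Hom (fobj X) (fobj Y);
  fmap_id : forall X, fmap (idm X) = idm (fobj X);
  fmap_comp : forall X Y Z (g : Hom Y Z) (f : Hom X Y),
    fmap (compm g f) = compm (fmap g) (fmap f)
}.
Arguments fmap {C D} _ {X Y} _.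

Definition id_functor (C : category) : functor C C :=
  @Functor C C id (fun _ _ f => f) (fun=> erefl) (fun _ _ _ _ _ => erefl).

Section FunctorComp.
Variables (C D E : category) (G : functor D E) (F : functor C D).

Lemma comp_fmap_id X : fmap G (fmap F (idm X)) = idm (G (F X)).
Proof. by rewrite !fmap_id. Qed.

Lemma comp_fmap_comp X Y Z (g : Hom Y Z) (f : Hom X Y) :
  fmap G (fmap F (compm g f)) = compm (fmap G (fmap F g)) (fmap G (fmap F f)).
Proof. by rewrite !fmap_comp. Qed.

Definition comp_functor : functor C E :=
  @Functor C E (fun X => G (F X)) (fun _ _ f => fmap G (fmap F f))
    comp_fmap_id comp_fmap_comp.

End FunctorComp.

Record nat_trans (C D : category) (F G : functor C D) := NatTrans {
  ncomp :> forall X, Hom (F X) (G X);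
  naturality : forall X Y (f : Hom X Y),
    compm (fmap G f) (ncomp X) = compm (ncomp Y) (fmap F f)
}.

Definition is_iso (C : category) (X Y : C) (f : Hom X Y) : Prop :=
  exists g : Hom Y X, compm g f = idm X /\ compm f g = idm Y.

Definition is_nat_iso (C D : category) (F G : functor C D)
  (eta : nat_trans F G) : Prop := forall X, is_iso (eta X).

Definition is_adjunction (C D : category) (F : functor C D) (G : functor D C)
  (eta : nat_trans (id_functor C) (comp_functor G F))
  (eps : nat_trans (comp_functor F G) (id_functor D)) : Prop :=
  (forall X : C, compm (eps (F X)) (fmap F (eta X)) = idm (F X)) /\
  (forall Y : D, compm (fmap G (eps Y)) (eta (G Y)) = idm (G Y)).

Definition adjoint_equivalence (C D : category)
  (F : functor C D) (G : functor D C) : Prop :=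
  exists (eta : nat_trans (id_functor C) (comp_functor G F))
         (eps : nat_trans (comp_functor F G) (id_functor D)),
  [/\ is_adjunction eta eps, is_nat_iso eta & is_nat_iso eps].

Definition equivalent_categories (C D : category) : Prop :=
  exists (F : functor C D) (G : functor D C)
         (eta : nat_trans (id_functor C) (comp_functor G F))
         (eps : nat_trans (comp_functor F G) (id_functor D)),
  is_nat_iso eta /\ is_nat_iso eps.

Definition full_subcategory (C : category) (P : C -> Prop) : category :=
  @Category {X : C | P X} (fun X Y => Hom (sval X) (sval Y))
    (fun X => idm (sval X)) (fun _ _ _ g f => compm g f)
    (fun _ _ _ _ h g f => compmA h g f)
    (fun _ _ f => comp1m f) (fun _ _ f => compm1 f).

Section ModuleCategory.
Variable B : pzRingType.

Lemma linear_ext (V W : lmodType B) (f g : {linear V -> W}) : f =1 g -> f = g.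
Proof.
case: f => f cf; case: g => g cg /= /funext fg; case: _ / fg cg => cg.
congr GRing.Linear.Pack.
case: cf => [[z1] [s1]]; case: cg => [[z2] [s2]].
by rewrite (Prop_irrelevance z1 z2) (Prop_irrelevance s1 s2).
Qed.

Definition Mod_comp (V W X : lmodType B) (g : {linear W -> X})
  (f : {linear V -> W}) : {linear V -> X} := g \o f.

Definition Mod_id (V : lmodType B) : {linear V -> V} := idfun.

Lemma Mod_compA (V W X Y : lmodType B) (h : {linear X -> Y})
    (g : {linear W -> X}) (f : {linear V -> W}) :
  Mod_comp h (Mod_comp g f) = Mod_comp (Mod_comp h g) f.
Proof. exact: linear_ext. Qed.

Lemma Mod_comp1 (V W : lmodType B) (f : {linear V -> W}) :
  Mod_comp (Mod_id W) f = f.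
Proof. exact: linear_ext. Qed.

Lemma Mod_compr1 (V W : lmodType B) (f : {linear V -> W}) :
  Mod_comp f (Mod_id V) = f.
Proof. exact: linear_ext. Qed.

Definition Mod : category :=
  @Category (lmodType B) (fun V W => {linear V -> W}) Mod_id Mod_comp
    Mod_compA Mod_comp1 Mod_compr1.

End ModuleCategory.

Record idempotent_of (B : pzRingType) := Idempotent {
  idem :> B;
  idemM : idem * idem = idem
}.

Section Corner.
Variables (B : pzRingType) (e : idempotent_of B).

Definition in_corner : pred B := fun x => `[< exists y, x = (e : B) * y * (e : B) >].

Lemma in_corner_zmod_closed : zmod_closed in_corner.
Proof.
split; first by apply/asboolP; exists 0; rewrite mulr0 mul0r.
move=> x y /asboolP[x' ->] /asboolP[y' ->]; apply/asboolP.
by exists (x' - y'); rewrite mulrBr mulrBl.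
Qed.

HB.instance Definition _ :=
  GRing.isZmodClosed.Build B in_corner in_corner_zmod_closed.

Record corner : Type := Corner {
  corner_val : B;
  corner_valP : corner_val \in in_corner
}.

HB.instance Definition _ := [isSub of corner for corner_val].
HB.instance Definition _ := [Choice of corner by <:].
HB.instance Definition _ := [SubChoice_isSubZmodule of corner by <:].

Lemma corner_fixl x : x \in in_corner -> (e : B) * x = x.
Proof. by move=> /asboolP[y ->]; rewrite !mulrA idemM. Qed.

Lemma corner_fixr x : x \in in_corner -> x * (e : B) = x.
Proof. by move=> /asboolP[y ->]; rewrite -!mulrA idemM. Qed.

Lemma corner_mul_subproof (x y : corner) :
  corner_val x * corner_val y \in in_corner.
Proof.
apply/asboolP; exists (corner_val x * corner_val y).
by rewrite mulrA corner_fixl ?corner_valP// -mulrA corner_fixr ?corner_valP.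
Qed.

Lemma corner_one_subproof : (e : B) \in in_corner.
Proof. by apply/asboolP; exists 1; rewrite mulr1 idemM. Qed.

Definition corner_mul (x y : corner) : corner := Corner (corner_mul_subproof x y).
Definition corner_one : corner := Corner corner_one_subproof.

Lemma corner_mulA : associative corner_mul.
Proof. by move=> x y z; apply: val_inj; rewrite /= mulrA. Qed.

Lemma corner_mul1 : left_id corner_one corner_mul.
Proof. by move=> x; apply: val_inj; exact/corner_fixl/corner_valP. Qed.

Lemma corner_mulr1 : right_id corner_one corner_mul.
Proof. by move=> x; apply: val_inj; exact/corner_fixr/corner_valP. Qed.

Lemma corner_mulDl : left_distributive corner_mul +%R.
Proof. by move=> x y z; apply: val_inj; exact: mulrDl. Qed.

Lemma corner_mulDr : right_distributive corner_mul +%R.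
Proof. by move=> x y z; apply: val_inj; exact: mulrDr. Qed.

HB.instance Definition _ := GRing.Zmodule_isPzRing.Build corner
  corner_mulA corner_mul1 corner_mulr1 corner_mulDl corner_mulDr.

Section CutModule.
Variable V : lmodType B.

Definition in_cut : pred V := fun v => `[< exists u, v = (e : B) *: u >].

Lemma in_cut_zmod_closed : zmod_closed in_cut.
Proof.
split; first by apply/asboolP; exists 0; rewrite scaler0.
move=> x y /asboolP[x' ->] /asboolP[y' ->]; apply/asboolP.
by exists (x' - y'); rewrite scalerBr.
Qed.

HB.instance Definition _ := GRing.isZmodClosed.Build V in_cut in_cut_zmod_closed.

Record cut : Type := Cut { cut_val : V; cut_valP : cut_val \in in_cut }.

HB.instance Definition _ := [isSub of cut for cut_val].
HB.instance Definition _ := [Choice of cut by <:].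
HB.instance Definition _ := [SubChoice_isSubZmodule of cut by <:].

Lemma cut_fix v : v \in in_cut -> (e : B) *: v = v.
Proof. by move=> /asboolP[u ->]; rewrite scalerA idemM. Qed.

Lemma cut_scale_subproof (x : corner) (v : cut) :
  corner_val x *: cut_val v \in in_cut.
Proof.
apply/asboolP; exists (corner_val x *: cut_val v).
by rewrite scalerA corner_fixl ?corner_valP.
Qed.

Definition cut_scale (x : corner) (v : cut) : cut := Cut (cut_scale_subproof x v).

Lemma cut_scaleA x y v : cut_scale x (cut_scale y v) = cut_scale (x * y) v.
Proof. by apply: val_inj; rewrite /= scalerA. Qed.

Lemma cut_scale1 : left_id 1 cut_scale.
Proof. by move=> v; apply: val_inj; exact/cut_fix/cut_valP. Qed.

Lemma cut_scaleDr : right_distributive cut_scale +%R.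
Proof. by move=> x u v; apply: val_inj; exact: scalerDr. Qed.

Lemma cut_scaleDl v : {morph cut_scale^~ v : x y / x + y}.
Proof. by move=> x y; apply: val_inj; exact: scalerDl. Qed.

HB.instance Definition _ := GRing.Zmodule_isLmodule.Build corner cut
  cut_scaleA cut_scale1 cut_scaleDr cut_scaleDl.

End CutModule.

Section CutMap.
Variables (V W : lmodType B) (g : {linear V -> W}).

Lemma cut_map_subproof (v : cut V) : g (cut_val v) \in @in_cut W.
Proof.
case: v => v /= /asboolP[u ->]; apply/asboolP; exists (g u).
by rewrite linearZ.
Qed.

Definition cut_map (v : cut V) : cut W := Cut (cut_map_subproof v).

Lemma cut_map_is_zmod_morphism : zmod_morphism cut_map.
Proof. by move=> u v; apply: val_inj; exact: raddfB. Qed.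

Lemma cut_map_is_scalable : scalable cut_map.
Proof. by move=> x v; apply: val_inj; exact: linearZ. Qed.

HB.instance Definition _ :=
  GRing.isZmodMorphism.Build (cut V) (cut W) cut_map cut_map_is_zmod_morphism.
HB.instance Definition _ :=
  GRing.isScalable.Build corner (cut V) (cut W) *:%R cut_map cut_map_is_scalable.

Definition cut_linear : {linear cut V -> cut W} := cut_map.

End CutMap.

Lemma cut_functor_id (V : Mod B) : cut_linear (idm V) = idm (cut V : Mod corner).
Proof. by apply: linear_ext => v; exact: val_inj. Qed.

Lemma cut_functor_comp (V W X : Mod B) (g : Hom W X) (f : Hom V W) :
  cut_linear (compm g f) =
  compm (c := Mod corner) (cut_linear g) (cut_linear f).
Proof. by apply: linear_ext => v; exact: val_inj. Qed.

Definition cut_functor : functor (Mod B) (Mod corner) :=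
  @Functor (Mod B) (Mod corner) (fun V => cut V)
    (fun V W g => cut_linear g) cut_functor_id cut_functor_comp.

Definition in_Be : pred B := fun x => `[< exists y, x = y * (e : B) >].

Lemma in_Be_zmod_closed : zmod_closed in_Be.
Proof.
split; first by apply/asboolP; exists 0; rewrite mul0r.
move=> x y /asboolP[x' ->] /asboolP[y' ->]; apply/asboolP.
by exists (x' - y'); rewrite mulrBl.
Qed.

HB.instance Definition _ := GRing.isZmodClosed.Build B in_Be in_Be_zmod_closed.

Record left_ideal : Type := LeftIdeal {
  lid_val : B;
  lid_valP : lid_val \in in_Be
}.

HB.instance Definition _ := [isSub of left_ideal for lid_val].
HB.instance Definition _ := [Choice of left_ideal by <:].
HB.instance Definition _ := [SubChoice_isSubZmodule of left_ideal by <:].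

Lemma lid_fix x : x \in in_Be -> x * (e : B) = x.
Proof. by move=> /asboolP[y ->]; rewrite -mulrA idemM. Qed.

Lemma lid_ract_subproof (x : left_ideal) (s : corner) :
  lid_val x * corner_val s \in in_Be.
Proof.
apply/asboolP; exists (lid_val x * corner_val s).
by rewrite -mulrA corner_fixr ?corner_valP.
Qed.

Lemma lid_lact_subproof (b : B) (x : left_ideal) : b * lid_val x \in in_Be.
Proof.
by apply/asboolP; exists (b * lid_val x); rewrite -mulrA lid_fix ?lid_valP.
Qed.

Definition lid_ract (x : left_ideal) (s : corner) : left_ideal :=
  LeftIdeal (lid_ract_subproof x s).
Definition lid_lact (b : B) (x : left_ideal) : left_ideal :=
  LeftIdeal (lid_lact_subproof b x).

Section InducedModule.
Variable V : lmodType corner.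

Definition induced : Type := tens lid_ract (fun (s : corner) (v : V) => s *: v).
HB.instance Definition _ := GRing.Zmodule.on induced.

Definition ipure (x : left_ideal) (v : V) : induced :=
  pure lid_ract (fun (s : corner) (v : V) => s *: v) x v.

Lemma ipureDl x x' v : ipure (x + x') v = ipure x v + ipure x' v.
Proof. exact: pureDl. Qed.

Lemma ipureDr x v v' : ipure x (v + v') = ipure x v + ipure x v'.
Proof. exact: pureDr. Qed.

Lemma ipure_bal x s v : ipure (lid_ract x s) v = ipure x (s *: v).
Proof. exact: pure_bal. Qed.

Lemma ind_ind (P : induced -> Prop) :
  P 0 -> (forall x y, P x -> P y -> P (x + y)) ->
  (forall x v, P (ipure x v)) -> forall x, P x.
Proof. exact: tens_ind. Qed.

Definition ind_scale (b : B) : induced -> induced :=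
  tens_lift (fun x v => ipure (lid_lact b x) v).

Lemma ind_scale_compat b :
  [/\ forall x x' v, ipure (lid_lact b (x + x')) v =
                     ipure (lid_lact b x) v + ipure (lid_lact b x') v,
      forall x v v', ipure (lid_lact b x) (v + v') =
                     ipure (lid_lact b x) v + ipure (lid_lact b x) v' &
      forall x s v, ipure (lid_lact b (lid_ract x s)) v =
                    ipure (lid_lact b x) (s *: v)].
Proof.
split=> [x x' v|x v v'|x s v]; last 1 first.
- rewrite -ipure_bal; congr ipure; apply: val_inj; exact: mulrA.
- by rewrite -ipureDl; congr ipure; apply: val_inj; exact: mulrDr.
- exact: ipureDr.
Qed.

Lemma ind_scale_pure b x v : ind_scale b (ipure x v) = ipure (lid_lact b x) v.
Proof. by have [h1 h2 h3] := ind_scale_compat b; exact: tens_lift_pure. Qed.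

Lemma ind_scaleDr : right_distributive ind_scale +%R.
Proof. by move=> b; have [h1 h2 h3] := ind_scale_compat b; exact: tens_liftD. Qed.

Lemma ind_scale0 b : ind_scale b 0 = 0.
Proof. by apply: (addrI (ind_scale b 0)); rewrite -ind_scaleDr !addr0. Qed.

Lemma ind_scaleA b c z : ind_scale b (ind_scale c z) = ind_scale (b * c) z.
Proof.
elim/ind_ind: z => [|y z ey ez|x v]; first by rewrite !ind_scale0.
  by rewrite !ind_scaleDr ey ez.
rewrite !ind_scale_pure; congr ipure; apply: val_inj; exact: mulrA.
Qed.

Lemma ind_scale1 : left_id 1 ind_scale.
Proof.
elim/ind_ind => [|y z ey ez|x v]; first by rewrite ind_scale0.
  by rewrite ind_scaleDr ey ez.
rewrite ind_scale_pure; congr ipure; apply: val_inj; exact: mul1r.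
Qed.

Lemma ind_scaleDl z : {morph ind_scale^~ z : b c / b + c}.
Proof.
move=> b c; elim/ind_ind: z => [|y z ey ez|x v].
- by rewrite !ind_scale0 addr0.
- by rewrite !ind_scaleDr ey ez addrACA.
- rewrite !ind_scale_pure -ipureDl; congr ipure; apply: val_inj; exact: mulrDl.
Qed.

HB.instance Definition _ := GRing.Zmodule_isLmodule.Build B induced
  ind_scaleA ind_scale1 ind_scaleDr ind_scaleDl.

Lemma ipureZ b x v : b *: (ipure x v : induced) = ipure (lid_lact b x) v.
Proof. exact: ind_scale_pure. Qed.

End InducedModule.

Section InducedMap.
Variables (V W : lmodType corner) (g : {linear V -> W}).

Definition ind_map : induced V -> induced W :=
  tens_lift (fun x v => ipure x (g v)).

Lemma ind_map_compat :
  [/\ forall x x' v, ipure (x + x') (g v) = ipure x (g v) + ipure x' (g v),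
      forall x v v', ipure x (g (v + v')) = ipure x (g v) + ipure x (g v') &
      forall x s v, ipure (lid_ract x s) (g v) = ipure x (g (s *: v))].
Proof.
split=> [x x' v|x v v'|x s v]; first exact: ipureDl.
- by rewrite raddfD ipureDr.
- by rewrite linearZ ipure_bal.
Qed.

Lemma ind_map_pure x v : ind_map (ipure x v) = ipure x (g v).
Proof. by have [h1 h2 h3] := ind_map_compat; exact: tens_lift_pure. Qed.

Lemma ind_mapD y z : ind_map (y + z) = ind_map y + ind_map z.
Proof. by have [h1 h2 h3] := ind_map_compat; exact: tens_liftD. Qed.

Lemma ind_map_is_zmod_morphism : zmod_morphism ind_map.
Proof.
by move=> y z; apply: (addIr (ind_map z)); rewrite -ind_mapD !subrK.
Qed.

HB.instance Definition _ := GRing.isZmodMorphism.Build (induced V) (induced W)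
  ind_map ind_map_is_zmod_morphism.

Lemma ind_map_is_scalable : scalable ind_map.
Proof.
move=> b z; elim/ind_ind: z => [|y z ey ez|x v].
- by rewrite scaler0 raddf0 scaler0.
- by rewrite ind_mapD !scalerDr ind_mapD ey ez.
- by rewrite ipureZ !ind_map_pure ipureZ.
Qed.

HB.instance Definition _ := GRing.isScalable.Build B (induced V) (induced W)
  *:%R ind_map ind_map_is_scalable.

Definition ind_linear : {linear induced V -> induced W} := ind_map.

End InducedMap.

Lemma ind_linear_ext (V : lmodType corner) (W : lmodType B)
    (g h : {linear induced V -> W}) :
  (forall x v, g (ipure x v) = h (ipure x v)) -> g = h.
Proof.
move=> gh; apply: linear_ext => z; elim/ind_ind: z => [|y z ey ez|//].
- by rewrite !linear0.
- by rewrite !linearD ey ez.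
Qed.

Lemma ind_functor_id (V : Mod corner) :
  ind_linear (idm V) = idm (induced V : Mod B).
Proof. by apply: ind_linear_ext => x v; exact: ind_map_pure. Qed.

Lemma ind_functor_comp (V W X : Mod corner) (g : Hom W X) (f : Hom V W) :
  ind_linear (compm g f) = compm (c := Mod B) (ind_linear g) (ind_linear f).
Proof. by apply: ind_linear_ext => x v; rewrite /= !ind_map_pure. Qed.

Definition ind_functor : functor (Mod corner) (Mod B) :=
  @Functor (Mod corner) (Mod B) (fun V => induced V)
    (fun V W g => ind_linear g) ind_functor_id ind_functor_comp.

End Corner.

Section Block.
Variables (B : pzRingType) (c : B).

Definition in_block (V : lmodType B) : Prop :=
  ([set: V] = [set c *: v | v in [set: V]])%classic.

Definition block : category := full_subcategory (in_block : Mod B -> Prop).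

Definition block_functor (D : category) (F : functor D (Mod B))
    (hF : forall X, in_block (F X)) : functor D block :=
  @Functor D block (fun X => exist in_block (F X) (hF X))
    (fun X Y f => fmap F f) (fun X => fmap_id F X)
    (fun X Y Z g f => fmap_comp F g f).

Definition block_restr (D : category) (F : functor (Mod B) D) :
    functor block D :=
  @Functor block D (fun V => F (sval V)) (fun V W g => fmap F g)
    (fun V => fmap_id F (sval V)) (fun V W X g f => fmap_comp F g f).

End Block.

Lemma induced_in_block (B : pzRingType) (c : B) (e : idempotent_of B)
    (V : lmodType (corner e)) :
  (forall x, c * x = x * c) -> c * idem e = idem e -> in_block c (induced V).
Proof.
move=> cC ce; apply/seteqP; split=> // z _ /=; exists z => //.
elim/ind_ind: z => [|y z ey ez|x v]; first by rewrite scaler0.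
  by rewrite scalerDr ey ez.
rewrite ipureZ; congr ipure; apply: val_inj => /=.
by case: x => x /= /asboolP[y ->]; rewrite mulrA cC -mulrA ce.
Qed.

Section HeckeAlgebra.
Variables (K : comPzRingType) (q a : K) (b n : nat).

Definition ord_lo (i : 'I_n.-1) : 'I_n := widen_ord (leq_pred n) i.

Lemma ord_hi_subproof (i : 'I_n.-1) : (i.+1 < n)%N.
Proof. by rewrite -ltn_predRL. Qed.

Definition ord_hi (i : 'I_n.-1) : 'I_n := Ordinal (ord_hi_subproof i).

Definition s_ (i : 'I_n.-1) : {perm 'I_n} := tperm (ord_lo i) (ord_hi i).

Definition gens : Type := ('I_n + 'I_n.-1)%type.

Declare Scope term_scope.
Delimit Scope term_scope with term.
Local Notation "x + y" := (Add x y) : term_scope.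
Local Notation "x * y" := (Mul x y) : term_scope.
Local Notation "x ^ m" := (Exp x m) : term_scope.
Local Notation T j := (Gen (inl j : gens)).
Local Notation R i := (Gen (inr i : gens)).

(* As T^b = 1, the inverse power T_{i+1}^{-k} is written T_{i+1}^{b-k}. *)
Definition E_term (i : 'I_n.-1) : term K gens :=
  Sum [seq (T (ord_lo i) ^ k * T (ord_hi i) ^ (b - k))%term | k <- iota 0 b].

Inductive hecke_rel : term K gens -> term K gens -> Prop :=
| hecke_order j : hecke_rel (T j ^ b)%term (Const 1)
| hecke_TT j j' : hecke_rel (T j * T j')%term (T j' * T j)%term
| hecke_TR j i : hecke_rel (T j * R i)%term (R i * T (s_ i j))%term
| hecke_RR (i i' : 'I_n.-1) of (i.+1 < i')%N || (i'.+1 < i)%N :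
    hecke_rel (R i * R i')%term (R i' * R i)%term
| hecke_braid (i i' : 'I_n.-1) of i' = i.+1 :> nat :
    hecke_rel (R i * R i' * R i)%term (R i' * R i * R i')%term
| hecke_quad i :
    hecke_rel (R i ^ 2)%term
      (Const q + Const a * T (ord_lo i) ^ ((b ^ 2 - b) %/ 2) * E_term i * R i)%term.

End HeckeAlgebra.

(* Z[q, a]; the inner variable ['X%:P] is q and the outer one ['X] is a. *)
Definition Zqa : comNzRingType := {poly {poly int}}.

Definition heckeZ (b n : nat) : pzAlgebra Zqa :=
  presAlg (@hecke_rel Zqa 'X%:P 'X b n).

(* [alg_closure], through [emb], is an algebraic closure of C(q, a), where again
   q is the inner variable and a the outer one. *)
Record setting := Setting {
  real_field : realType;
  size_n : nat;
  order_b : nat;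
  size_n_gt0 : (0 < size_n)%N;
  order_b_gt0 : (0 < order_b)%N;
  zeta : real_field[i];
  zetaP : order_b.-primitive_root zeta;
  alg_closure : closedFieldType;
  emb : {rmorphism {fraction {poly {poly real_field[i]}}} -> alg_closure};
  emb_algebraic : forall z : alg_closure, algebraicOver emb z;
  sqrt_disc : alg_closure;
  sqrt_discP : sqrt_disc ^+ 2 =
    order_b%:R ^+ 2 * emb (tofrac 'X) ^+ 2 + 4%:R * emb (tofrac 'X%:P)
}.

Section CoefficientRing.
Variable S : setting.

Local Notation L := (alg_closure S).
Local Notation n := (size_n S).
Local Notation b := (order_b S).

Definition qL : L := emb S (tofrac 'X%:P).
Definition aL : L := emb S (tofrac 'X).
Definition zetaL : L := emb S (tofrac (zeta S)%:P%:P).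
Definition xL : L :=
  (b%:R ^+ 2 * aL ^+ 2 + b%:R * aL * sqrt_disc S + 2%:R * qL) / (2%:R * qL).

Definition unit_in (P : set L) (u : L) : Prop :=
  P u /\ exists2 v, P v & u * v = 1.

Record admissible (P : set L) : Prop := Admissible {
  adm_1 : P 1;
  adm_B : forall x y, P x -> P y -> P (x - y);
  adm_M : forall x y, P x -> P y -> P (x * y);
  adm_qL : P qL;
  adm_aL : P aL;
  adm_zetaL : P zetaL;
  adm_sqrt : P (sqrt_disc S);
  adm_unit2 : unit_in P 2%:R;
  adm_unitb : unit_in P b%:R;
  adm_unitq : unit_in P qL;
  adm_unitx : forall k : nat, (1 <= k <= n - 2)%N ->
    unit_in P (\sum_(i < k.+1) xL ^+ i)
}.

(* the smallest [admissible] subset *)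
Definition inA : pred L := fun z => `[< forall P, admissible P -> P z >].

Lemma inA_subring_closed : subring_closed inA.
Proof.
split.
- by apply/asboolP => P []. 
- move=> x y /asboolP xA /asboolP yA; apply/asboolP => P admP.
  by apply: (adm_B admP); [exact: xA | exact: yA].
- move=> x y /asboolP xA /asboolP yA; apply/asboolP => P admP.
  by apply: (adm_M admP); [exact: xA | exact: yA].
Qed.

HB.instance Definition _ :=
  GRing.isSubringClosed.Build L inA inA_subring_closed.

Record coefA : Type := CoefA { A_val : L; A_valP : A_val \in inA }.

HB.instance Definition _ := [isSub of coefA for A_val].
HB.instance Definition _ := [Choice of coefA by <:].
HB.instance Definition _ := [SubChoice_isSubComNzRing of coefA by <:].

Definition A_unit : pred coefA :=
  fun x => (A_val x != 0) && ((A_val x)^-1 \in inA).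
Definition A_inv (x : coefA) : coefA := insubd x (A_val x)^-1.

Lemma A_mulVx : {in A_unit, left_inverse 1 A_inv *%R}.
Proof.
move=> x /andP[x0 xV]; apply: val_inj.
by rewrite /= /A_inv val_insubd xV mulVf.
Qed.

Lemma A_unitPl x y : y * x = 1 -> A_unit x.
Proof.
move=> /(congr1 val) /= yx1.
have x0 : A_val x != 0.
  by apply: contra_eq_neq yx1 => ->; rewrite mulr0 eq_sym oner_neq0.
apply/andP; split=> //; suff -> : (A_val x)^-1 = A_val y by exact: A_valP.
by apply: (mulIf x0); rewrite mulVf.
Qed.

Lemma A_inv_out : {in [predC A_unit], A_inv =1 id}.
Proof.
move=> x; rewrite inE /= /in_mem /= /A_unit negb_and negbK => /orP[/eqP x0|xV].
  by apply: val_inj; rewrite /A_inv val_insubd /= x0 invr0 if_same.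
by apply: val_inj; rewrite /A_inv val_insubd (negbTE xV).
Qed.

HB.instance Definition _ :=
  GRing.ComNzRing_hasMulInverse.Build coefA A_mulVx A_unitPl A_inv_out.

Lemma A_integral (x y : coefA) : x * y = 0 -> (x == 0) || (y == 0).
Proof.
move=> /(congr1 val) /= /eqP; rewrite mulf_eq0.
by case/orP => /eqP h; apply/orP; [left|right]; apply/eqP/val_inj.
Qed.

HB.instance Definition _ := GRing.ComUnitRing_isIntegral.Build coefA A_integral.

Lemma qA_subproof : qL \in inA. Proof. by apply/asboolP => P []. Qed.
Lemma aA_subproof : aL \in inA. Proof. by apply/asboolP => P []. Qed.

Definition qA : coefA := CoefA qA_subproof.
Definition aA : coefA := CoefA aA_subproof.

Definition evA : {rmorphism Zqa -> coefA} :=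
  horner_eval aA \o map_poly (horner_eval qA \o map_poly intr).

Lemma natL_neq0 m : (m.+1%:R : L) != 0.
Proof.
rewrite -(rmorph_nat (emb S)) fmorph_eq0 -(rmorph_nat (@tofrac _)) tofrac_eq0.
by rewrite -!polyC_natr !polyC_eq0 pnatr_eq0.
Qed.

Lemma b_unit : (b%:R : coefA) \is a GRing.unit.
Proof.
have b0 : (b%:R : L) != 0 by rewrite -(prednK (order_b_gt0 S)) natL_neq0.
have e : A_val (b%:R : coefA) = b%:R by exact: (rmorph_nat (val : coefA -> L)).
apply/andP; rewrite e; split=> //; apply/asboolP => P admP.
have [_ [v Pv bv]] := adm_unitb admP.
have -> // : (b%:R : L)^-1 = v by apply: (mulfI b0); rewrite bv mulfV.
Qed.

Definition heckeA : pzAlgebra coefA := baseChange evA (heckeZ b n).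

Definition T_ (j : 'I_n) : heckeA :=
  one_tens evA (heckeZ b n) (pcl (Gen (inl j : gens n))).
Definition R_ (i : 'I_n.-1) : heckeA :=
  one_tens evA (heckeZ b n) (pcl (Gen (inr i : gens n))).

End CoefficientRing.

Section DiagonalGroup.
Variable S : setting.

Local Notation C := (real_field S)[i].
Local Notation n := (size_n S).
Local Notation b := (order_b S).

Definition in_D : pred 'M[C]_n := fun M =>
  is_diag_mx M && [forall i, [exists k : 'I_b, M i i == zeta S ^+ k]].

Record D : Type := DiagElt { D_val : 'M[C]_n; D_valP : in_D D_val }.

HB.instance Definition _ := [isSub of D for D_val].
HB.instance Definition _ := [Equality of D by <:].

(* the exponents p_i < b such that d = diag(zeta^p_1, ..., zeta^p_n) *)
Definition D_exp (d : D) : {ffun 'I_n -> 'I_b} :=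
  [ffun i => xchoose (existsP (forallP (andP (D_valP d)).2 i))].

Definition diag_of (p : 'I_n -> nat) : 'M[C]_n :=
  diag_mx (\row_i zeta S ^+ p i).

Lemma zeta_mod m : zeta S ^+ (m %% b) = zeta S ^+ m.
Proof. by rewrite (prim_expr_mod (zetaP S)). Qed.

Lemma diag_of_subproof p : in_D (diag_of p).
Proof.
apply/andP; split; first exact: diag_mx_is_diag.
apply/forallP => i; apply/existsP.
exists (Ordinal (ltn_pmod (p i) (order_b_gt0 S))).
by rewrite /= zeta_mod !mxE eqxx mulr1n.
Qed.

Definition D_of (p : 'I_n -> nat) : D := DiagElt (diag_of_subproof p).

Lemma D_expE d i : D_val d i i = zeta S ^+ D_exp d i.
Proof.
by rewrite ffunE; apply/eqP; exact: (xchooseP (existsP (forallP (andP (D_valP d)).2 i))).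
Qed.

Lemma D_off d i j : i != j -> D_val d i j = 0.
Proof. by case: d => M /= /andP[/is_diag_mxP Md _] /Md. Qed.

Lemma D_ext (d d' : D) : (forall i, D_val d i i = D_val d' i i) -> d = d'.
Proof.
move=> e; apply: val_inj; apply/matrixP => i j /=.
by have [<-|ij] := eqVneq i j; [exact: e | rewrite !D_off].
Qed.

Lemma D_ofE p i : D_val (D_of p) i i = zeta S ^+ p i.
Proof. by rewrite !mxE eqxx mulr1n. Qed.

Lemma D_expK : cancel D_exp (fun p : {ffun 'I_n -> 'I_b} => D_of (fun i => p i)).
Proof. by move=> d; apply: D_ext => i; rewrite D_ofE D_expE. Qed.

Lemma D_ofK : cancel (fun p : {ffun 'I_n -> 'I_b} => D_of (fun i => p i)) D_exp.
Proof.
move=> p; apply/ffunP => i; apply: val_inj.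
have /eqP := D_expE (D_of (fun i => p i)) i; rewrite D_ofE.
by rewrite (eq_prim_root_expr (zetaP S)) !modn_small // => /eqP.
Qed.

HB.instance Definition _ := CanIsCountable D_expK.
HB.instance Definition _ : isFinite D := CanIsFinite D_expK.

Lemma card_D : #|{: D}| = (b ^ n)%N.
Proof.
rewrite -[in RHS](card_ord n) -[in RHS](card_ord b) -card_ffun.
by apply: bij_eq_card; exists (fun p : {ffun 'I_n -> 'I_b} => D_of (fun i => p i));
  [exact: D_expK | exact: D_ofK].
Qed.

Lemma D_mul_diag (d d' : D) :
  D_val d *m D_val d' = diag_of (fun i => D_exp d i + D_exp d' i)%N.
Proof.
rewrite -[d in LHS]D_expK -[d' in LHS]D_expK /= mulmx_diag; congr diag_mx.
by apply/rowP => i; rewrite !mxE exprD.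
Qed.

Lemma D_mul_subproof (d d' : D) : in_D (D_val d *m D_val d').
Proof. rewrite D_mul_diag; exact: diag_of_subproof. Qed.

Definition D_mul (d d' : D) : D := DiagElt (D_mul_subproof d d').
Definition D_one : D := D_of (fun=> 0%N).
Definition D_inv (d : D) : D := D_of (fun i => b - D_exp d i)%N.

Lemma D_mulE d d' i : D_val (D_mul d d') i i = D_val d i i * D_val d' i i.
Proof. by rewrite /= D_mul_diag !mxE eqxx mulr1n exprD !D_expE. Qed.

Lemma D_mulA : associative D_mul.
Proof. by move=> x y z; apply: val_inj; exact: mulmxA. Qed.

Lemma D_mulC : commutative D_mul.
Proof. by move=> x y; apply: D_ext => i; rewrite !D_mulE mulrC. Qed.

Lemma D_mul1 : left_id D_one D_mul.
Proof. by move=> x; apply: D_ext => i; rewrite D_mulE D_ofE mul1r. Qed.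

Lemma D_mulV : left_inverse D_one D_inv D_mul.
Proof.
move=> x; apply: D_ext => i; rewrite D_mulE !D_ofE D_expE -exprD.
by rewrite subnK ?(ltnW (ltn_ord _))// (prim_expr_order (zetaP S)).
Qed.

Lemma D_mulr1 : right_id D_one D_mul.
Proof. by move=> x; rewrite D_mulC D_mul1. Qed.

Lemma D_mulrV : right_inverse D_one D_inv D_mul.
Proof. by move=> x; rewrite D_mulC D_mulV. Qed.

HB.instance Definition _ := isGroup.Build D
  D_mulA D_mul1 D_mulr1 D_mulV D_mulrV.

Record W : Type := PermElt { W_val : 'M[C]_n; W_valP : is_perm_mx W_val }.

Definition W_of (s : {perm 'I_n}) : W := PermElt (perm_mx_is_perm _ s).

Lemma WP (w : W) : exists s, w = W_of s.
Proof.
case: w => M MP; have /existsP[s /eqP e] := MP; exists s.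
by rewrite /W_of; case: _ / (esym e) MP => MP; congr PermElt; exact: eq_irrelevance.
Qed.

Lemma conj_perm_diag (s : {perm 'I_n}) (d : D) :
  invmx (W_val (W_of s)) *m D_val d *m W_val (W_of s) =
  diag_of (fun i => D_exp d ((s^-1)%g i)).
Proof.
have -> : invmx (W_val (W_of s)) = perm_mx s^-1 :> 'M[C]_n.
  have h : perm_mx s *m perm_mx s^-1 = 1%:M :> 'M[C]_n.
    by rewrite -perm_mxM mulgV perm_mx1.
  have [u _] := mulmx1_unit h.
  by rewrite -[LHS]mulmx1 -h mulmxA mulVmx// mul1mx.
have -> : W_val (W_of s) = perm_mx (s^-1)^-1 :> 'M[C]_n by rewrite invgK.
rewrite -row_permE -col_permE; apply/matrixP => i j; rewrite !mxE.
have [<-|ij] := eqVneq i j; first by rewrite D_expE mulr1n.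
by rewrite mulr0n D_off// (inj_eq perm_inj).
Qed.

Lemma conjD_subproof (w : W) (d : D) :
  in_D (invmx (W_val w) *m D_val d *m W_val w).
Proof. have [s ->] := WP w; rewrite conj_perm_diag; exact: diag_of_subproof. Qed.

Definition conjD (w : W) (d : D) : D := DiagElt (conjD_subproof w d).

Lemma conjDE s d i : D_val (conjD (W_of s) d) i i = D_val d ((s^-1)%g i) ((s^-1)%g i).
Proof. by rewrite /= conj_perm_diag !mxE eqxx mulr1n D_expE. Qed.

Lemma conjDM w d d' : conjD w (d * d')%g = (conjD w d * conjD w d')%g.
Proof.
have [s ->] := WP w; apply: D_ext => i.
by rewrite [RHS]D_mulE !conjDE [LHS]D_mulE.
Qed.

Lemma conjD_perm s t d : conjD (W_of s) (conjD (W_of t) d) = conjD (W_of (t * s)) d.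
Proof. by apply: D_ext => i; rewrite !conjDE invMg permM. Qed.

Lemma conjD1 d : conjD (W_of 1) d = d.
Proof. by apply: D_ext => i; rewrite conjDE invg1 perm1. Qed.

Record XD : Type := Character {
  chi_fun :> D -> coefA S;
  chi_unit : forall d, chi_fun d \is a GRing.unit;
  chiM : forall d d', chi_fun (d * d')%g = chi_fun d * chi_fun d'
}.

HB.instance Definition _ := gen_eqMixin XD.
HB.instance Definition _ := gen_choiceMixin XD.

Lemma XD_ext (chi chi' : XD) : chi =1 chi' -> chi = chi'.
Proof.
case: chi => f fu fM; case: chi' => g gu gM /= /funext fg.
case: _ / fg gu gM => gu gM.
by rewrite (Prop_irrelevance fu gu) (Prop_irrelevance fM gM).
Qed.

Lemma actX_unit w (chi : XD) d : chi (conjD w d) \is a GRing.unit.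
Proof. exact: chi_unit. Qed.

Lemma actXM w (chi : XD) d d' :
  chi (conjD w (d * d')%g) = chi (conjD w d) * chi (conjD w d').
Proof. by rewrite conjDM chiM. Qed.

Definition actX (w : W) (chi : XD) : XD :=
  @Character (fun d => chi (conjD w d)) (actX_unit w chi) (actXM w chi).

Definition orbitX (chi : XD) : set XD :=
  [set chi' | exists w : W, chi' = actX w chi]%classic.

Definition orbits : Type := {alpha : set XD | exists chi, alpha = orbitX chi}.

Lemma chi1 (chi : XD) : chi 1%g = 1.
Proof.
by apply: (mulrI (chi_unit chi 1%g)); rewrite -chiM mulg1 mulr1.
Qed.

Lemma chiVM (chi : XD) d : chi (d^-1)%g * chi d = 1.
Proof. by rewrite -chiM mulVg chi1. Qed.

Local Notation H := (heckeA S).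
Local Notation sc := (alg_map H).

(* The exponents [D_exp d i] are those in [0, b); others would do, as T_i^b = 1. *)
Definition t_ (d : D) : H := \prod_(i < n) T_ i ^+ D_exp d i.

Definition e_ (chi : XD) : H :=
  sc (b%:R ^- n) * \sum_(d : D) sc (chi (d^-1)%g) * t_ d.

(* Orbits are finite ([orbit_finite]), so this finitely supported sum is the sum
   over the whole orbit. *)
Definition eO_ (alpha : orbits) : H := \sum_(chi \in sval alpha) e_ chi.

End DiagonalGroup.

Section Idempotents.
Variable S : setting.

Local Notation n := (size_n S).
Local Notation b := (order_b S).
Local Notation A := (coefA S).
Local Notation H := (heckeA S).
Local Notation HZ := (heckeZ b n).
Local Notation sc := (alg_map H).
Local Notation inj := (one_tens (evA S) HZ).

Lemma pcl_rel (t u : term Zqa (gens n)) :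
  hecke_rel 'X%:P 'X b t u -> pcl t = pcl u :> HZ.
Proof. by move=> tu; apply/pcl_eq/pres_rel. Qed.

Lemma pcl_add (t u : term Zqa (gens n)) : pcl (Add t u) = pcl t + pcl u :> HZ.
Proof. exact: pclD. Qed.

Lemma pcl_mul (t u : term Zqa (gens n)) : pcl (Mul t u) = pcl t * pcl u :> HZ.
Proof. exact: pclM. Qed.

Lemma pcl_exp (t : term Zqa (gens n)) m : pcl (Exp t m) = pcl t ^+ m :> HZ.
Proof. by elim: m => [//|m IH]; rewrite /= pcl_mul IH exprS. Qed.

Lemma T_order j : T_ j ^+ b = 1 :> H.
Proof. by rewrite -rmorphXn -pcl_exp (pcl_rel (hecke_order _ _ _ _)) rmorph1. Qed.

Lemma T_comm j j' : T_ j * T_ j' = T_ j' * T_ j :> H.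
Proof. by rewrite -!rmorphM -!pcl_mul (pcl_rel (hecke_TT _ _ _ _ _)). Qed.

Lemma T_R j i : T_ j * R_ i = R_ i * T_ (s_ i j) :> H.
Proof. by rewrite -!rmorphM -!pcl_mul (pcl_rel (hecke_TR _ _ _ _ _)). Qed.

Lemma H_central (x : H) :
  (forall j, x * T_ j = T_ j * x) -> (forall i, x * R_ i = R_ i * x) ->
  forall y, x * y = y * x.
Proof.
move=> xT xR; apply: baseChange_ind => [|y z ey ez|c y].
- by rewrite mulr0 mul0r.
- by rewrite mulrDr mulrDl ey ez.
rewrite mulrA -alg_map_central -!mulrA; congr (_ * _).
rewrite -(prepK y); elim: (prep y) => [d|[j|i]|t et u eu|t et u eu].
- have -> : pcl (Const d) = alg_map HZ d by [].
  by rewrite one_tens_map alg_map_central.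
- exact: xT.
- exact: xR.
- by rewrite pcl_add rmorphD mulrDr mulrDl et eu.
- by rewrite pcl_mul rmorphM mulrA et -mulrA eu mulrA.
Qed.

Section CommutingProducts.
Variables (B : pzRingType) (I : eqType) (F : I -> B).
Hypothesis FC : forall i j, F i * F j = F j * F i.

Lemma prod_commr (s : seq I) (x : B) :
  (forall i, x * F i = F i * x) ->
  x * (\prod_(i <- s) F i) = (\prod_(i <- s) F i) * x.
Proof.
move=> xF; elim: s => [|i s IH]; first by rewrite big_nil mulr1 mul1r.
by rewrite big_cons mulrA xF -!mulrA IH.
Qed.

Lemma perm_prod_comm (s t : seq I) :
  perm_eq s t -> \prod_(i <- s) F i = \prod_(i <- t) F i.
Proof.
have rem_prod (u : seq I) i : i \in u ->
    \prod_(j <- u) F j = F i * \prod_(j <- rem i u) F j.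
  elim: u => [//|j u IH]; rewrite inE big_cons /=.
  have [->//|ij] /= := eqVneq j i => iu.
  by rewrite big_cons (IH iu) !mulrA FC.
elim: s t => [|i s IH] t st.
  by have := perm_size st; case: t {st} => // _; rewrite big_nil.
have it : i \in t by rewrite -(perm_mem st) mem_head.
rewrite (rem_prod _ _ it) big_cons; congr (_ * _); apply: IH.
by have := perm_trans st (perm_to_rem it); rewrite perm_cons.
Qed.

End CommutingProducts.

Lemma prod_mul_comm (B : pzRingType) (I : eqType) (F G : I -> B) (s : seq I) :
  (forall i j, F i * G j = G j * F i) ->
  \prod_(i <- s) (F i * G i) = (\prod_(i <- s) F i) * (\prod_(i <- s) G i).
Proof.
move=> FG; elim: s => [|i s IH]; first by rewrite !big_nil mulr1.
rewrite !big_cons IH -!mulrA; congr (_ * _); rewrite !mulrA; congr (_ * _).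
by apply: (@prod_commr _ _ F) => j; rewrite FG.
Qed.

Lemma TX_comm j j' k k' : T_ j ^+ k * T_ j' ^+ k' = T_ j' ^+ k' * T_ j ^+ k :> H.
Proof. exact/commrX/commr_sym/commrX/T_comm. Qed.

Lemma TX_mod j k k' : (k = k' %[mod b])%N -> T_ j ^+ k = T_ j ^+ k' :> H.
Proof. by move=> kk'; rewrite -(expr_mod k (T_order j)) kk' expr_mod ?T_order. Qed.

Lemma t_M (d d' : D S) : t_ (d * d')%g = t_ d * t_ d'.
Proof.
rewrite /t_ -prod_mul_comm; last by move=> i j; exact: TX_comm.
apply: eq_bigr => i _; rewrite -exprD; apply: TX_mod; apply/eqP.
rewrite -(eq_prim_root_expr (zetaP S)) exprD -!D_expE.
by apply/eqP; exact: D_mulE.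
Qed.

Lemma t_T (d : D S) j : t_ d * T_ j = T_ j * t_ d.
Proof.
apply: esym; apply: (@prod_commr _ _ (fun i => T_ i ^+ D_exp d i)) => i.
by have := TX_comm j i 1 (D_exp d i); rewrite expr1.
Qed.

Lemma s_V i : ((@s_ n i)^-1)%g = s_ i.
Proof. exact: tpermV. Qed.

Lemma t_R (d : D S) i : t_ d * R_ i = R_ i * t_ (conjD (W_of (s_ i)) d).
Proof.
have pR (s : seq 'I_n) (p : 'I_n -> nat) :
    (\prod_(j <- s) T_ j ^+ p j : H) * R_ i =
    R_ i * \prod_(j <- s) T_ (s_ i j) ^+ p j.
  elim: s => [|j s IH]; first by rewrite !big_nil mulr1 mul1r.
  rewrite !big_cons -mulrA IH !mulrA; congr (_ * _).
  elim: (p j) => [|m IHm]; first by rewrite !expr0 mulr1 mul1r.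
  by rewrite !exprS -mulrA IHm mulrA T_R mulrA.
rewrite /t_ pR; congr (_ * _).
transitivity (\prod_(j <- [seq s_ i j | j <- index_enum 'I_n])
    T_ j ^+ D_exp d (s_ i j) : H).
  by rewrite big_map; apply: eq_bigr => j _; rewrite tpermK.
transitivity (\prod_j T_ j ^+ D_exp d (s_ i j) : H).
  apply: perm_prod_comm => [j j'|]; first exact: TX_comm.
  apply: uniq_perm; rewrite ?index_enum_uniq//.
    by rewrite map_inj_uniq ?index_enum_uniq//; exact: perm_inj.
  move=> j; rewrite mem_index_enum; apply/mapP; exists (s_ i j) => //.
  by rewrite tpermK.
apply: eq_bigr => j _; apply: TX_mod; apply/eqP.
by rewrite -(eq_prim_root_expr (zetaP S)) -!D_expE conjDE s_V.
Qed.

Lemma sum_reindexD (B : pzRingType) (d : D S) (F : D S -> B) :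
  \sum_d' F d' = \sum_d' F (d^-1 * d')%g.
Proof. exact/reindex_inj/mulgI. Qed.

Lemma t_e (d : D S) (chi : XD S) : t_ d * e_ chi = sc (chi d) * e_ chi.
Proof.
rewrite /e_ mulrA -alg_map_central -mulrA [RHS]mulrA -[sc (chi d) * _]rmorphM.
rewrite [chi d * _]mulrC rmorphM -[RHS]mulrA; congr (_ * _).
rewrite !mulr_sumr [LHS](sum_reindexD d); apply: eq_bigr => d' _.
rewrite mulrA -alg_map_central -mulrA -t_M mulgA mulgV mul1g.
by rewrite invgM invgK chiM mulrC rmorphM -mulrA.
Qed.

Lemma e_t (d : D S) (chi : XD S) : e_ chi * t_ d = sc (chi d) * e_ chi.
Proof.
rewrite -t_e /e_ mulrA -alg_map_central -!mulrA; congr (_ * _).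
rewrite mulr_suml mulr_sumr; apply: eq_bigr => d' _.
by rewrite mulrA -alg_map_central -!mulrA -!t_M [(d * d')%g]D_mulC.
Qed.

Lemma e_mul (chi chi' : XD S) :
  e_ chi * e_ chi' =
  sc (b%:R ^- n * \sum_(d : D S) chi (d^-1)%g * chi' d) * e_ chi'.
Proof.
rewrite [e_ chi]/e_ -mulrA mulr_suml rmorphM -[RHS]mulrA; congr (_ * _).
rewrite rmorph_sum mulr_suml; apply: eq_bigr => d _.
by rewrite -mulrA t_e rmorphM mulrA.
Qed.

Lemma e_idem (chi : XD S) : e_ chi * e_ chi = e_ chi.
Proof.
rewrite e_mul (eq_bigr (fun=> 1)) => [|d _]; last exact: chiVM.
rewrite sumr_const card_D natrX mulVr ?unitrX ?b_unit//.
by rewrite rmorph1 mul1r.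
Qed.

Lemma e_ortho (chi chi' : XD S) : chi <> chi' -> e_ chi * e_ chi' = 0.
Proof.
move=> neq; rewrite e_mul.
have [d0 d0P] : exists d0, chi d0 != chi' d0.
  apply: contrapT => h; apply: neq; apply: XD_ext => d.
  by apply: contrapT => /eqP h'; apply: h; exists d.
set s := \sum_(d : D S) _; suff -> : s = 0 by rewrite mulr0 rmorph0 mul0r.
have ds : chi' d0 * s = chi d0 * s.
  rewrite {1}/s (sum_reindexD d0) !mulr_sumr; apply: eq_bigr => d _.
  rewrite invgM invgK !chiM mulrCA !mulrA -[_ * chi' d0 * _]mulrA.
  by rewrite [chi' d0 * _]mulrC chiVM mulr1 [chi _ * chi d0]mulrC.
apply: (mulfI (_ : chi d0 - chi' d0 != 0)); first by rewrite subr_eq0.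
by rewrite mulr0 mulrBl ds subrr.
Qed.

Lemma conjDV (w : W S) (d : D S) : conjD w (d^-1)%g = (conjD w d)^-1%g.
Proof.
have w1 : conjD w 1%g = 1%g :> D S.
  by apply: (mulgI (conjD w 1%g)); rewrite -conjDM !mulg1.
by apply: (mulIg (conjD w d)); rewrite -conjDM !mulVg w1.
Qed.

Lemma orbit_finite (alpha : orbits S) : finite_set (sval alpha).
Proof.
case: alpha => _ /= [chi ->].
apply: (@sub_finite_set _ _ ((fun s => actX (W_of s) chi) @` setT)%classic).
  by move=> _ [w ->]; have [s ->] := WP w; exists s.
exact/finite_image/finite_finset.
Qed.

Lemma eO_E (alpha : orbits S) :
  eO_ alpha = \sum_(chi <- fset_set (sval alpha)) e_ chi.
Proof. by rewrite /eO_ fsbig_finite //; exact: orbit_finite. Qed.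

Lemma eO_e (alpha : orbits S) chi :
  sval alpha chi -> eO_ alpha * e_ chi = e_ chi.
Proof.
move=> achi; have fin := orbit_finite alpha.
rewrite eO_E (bigD1_seq chi) /= ?fset_uniq//; last first.
  by rewrite in_fset_set// inE.
rewrite mulrDl e_idem mulr_suml big1 ?addr0// => chi' /eqP; exact: e_ortho.
Qed.

Lemma actX_tperm i (chi : XD S) :
  actX (W_of (s_ i)) (actX (W_of (s_ i)) chi) = chi.
Proof.
by apply: XD_ext => d /=; rewrite conjD_perm tperm2 conjD1.
Qed.

Lemma orbit_act (alpha : orbits S) (s : {perm 'I_n}) (chi : XD S) :
  sval alpha chi -> sval alpha (actX (W_of s) chi).
Proof.
case: alpha => _ /= [chi0 ->] [w ->]; have [t ->] := WP w.
exists (W_of (s * t)); apply: XD_ext => d /=.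
by rewrite conjD_perm.
Qed.

Lemma e_T (chi : XD S) j : e_ chi * T_ j = T_ j * e_ chi.
Proof.
rewrite /e_ [RHS]mulrA -alg_map_central -!mulrA; congr (_ * _).
rewrite mulr_suml mulr_sumr; apply: eq_bigr => d _.
by rewrite -mulrA t_T !mulrA alg_map_central.
Qed.

Lemma e_R (chi : XD S) i : e_ chi * R_ i = R_ i * e_ (actX (W_of (s_ i)) chi).
Proof.
rewrite /e_ [RHS]mulrA -alg_map_central -!mulrA; congr (_ * _).
rewrite mulr_suml mulr_sumr.
have cK : involutive (@conjD S (W_of (s_ i))).
  by move=> d; rewrite conjD_perm tperm2 conjD1.
rewrite [RHS](reindex_inj (inv_inj cK)); apply: eq_bigr => d _.
rewrite -[actX _ _ _]/(chi (conjD (W_of (s_ i)) _)).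
have -> : conjD (W_of (s_ i)) (conjD (W_of (s_ i)) d)^-1%g = (d^-1)%g.
  by rewrite conjDV cK.
by rewrite -mulrA t_R !mulrA alg_map_central.
Qed.

Lemma eO_central (alpha : orbits S) x : eO_ alpha * x = x * eO_ alpha.
Proof.
have fin := orbit_finite alpha.
apply: H_central => [j|i]; rewrite eO_E mulr_suml mulr_sumr.
  by apply: eq_bigr => chi _; exact: e_T.
under eq_bigr do rewrite e_R.
set F := fun chi => R_ i * e_ chi.
rewrite -[RHS]/(\sum_(chi <- fset_set (sval alpha)) F chi).
rewrite -[LHS](big_map (actX (W_of (s_ i))) predT F).
apply: perm_big; apply: uniq_perm; rewrite ?fset_uniq//.
  rewrite map_inj_uniq ?fset_uniq//; apply: inv_inj; exact: actX_tperm.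
move=> chi; apply/mapP/idP => [[chi' c' ->]|c].
  move: c'; rewrite !in_fset_set// !inE; exact: orbit_act.
exists (actX (W_of (s_ i)) chi); last by rewrite actX_tperm.
move: c; rewrite !in_fset_set// !inE; exact: orbit_act.
Qed.

End Idempotents.

Section Specialization.
Variables (S : setting) (k : comPzRingType) (f : {rmorphism coefA S -> k}).

Definition fH : pzAlgebra k := baseChange f (heckeA S).

Definition fe (chi : XD S) : fH := one_tens f (heckeA S) (e_ chi).
Definition feO (alpha : orbits S) : fH := one_tens f (heckeA S) (eO_ alpha).

Lemma fe_idem chi : fe chi * fe chi = fe chi.
Proof. by rewrite /fe -rmorphM e_idem. Qed.

Definition fe_idempotent (chi : XD S) : idempotent_of fH := Idempotent (fe_idem chi).

Lemma feO_central alpha (x : fH) : feO alpha * x = x * feO alpha.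
Proof.
elim/baseChange_ind: x => [|x y ex ey|c x]; first by rewrite mulr0 mul0r.
  by rewrite mulrDr mulrDl ex ey.
by rewrite mulrA -alg_map_central -!mulrA -!rmorphM eO_central.
Qed.

Lemma feO_fe (alpha : orbits S) chi :
  sval alpha chi -> feO alpha * fe chi = fe chi.
Proof. by move=> achi; rewrite -rmorphM eO_e. Qed.

Definition fHalpha (chi : XD S) : pzRingType := corner (fe_idempotent chi).

Definition fblock (alpha : orbits S) : category := block (feO alpha).

Section Functors.
Variables (alpha : orbits S) (chi : XD S) (achi : sval alpha chi).

Lemma F_in_block (V : lmodType (fHalpha chi)) :
  in_block (feO alpha) (induced V).
Proof.
apply: induced_in_block; [exact: feO_central | exact: feO_fe].
Qed.

Definition F_functor : functor (Mod (fHalpha chi)) (fblock alpha) :=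
  block_functor (F := ind_functor (fe_idempotent chi)) F_in_block.

Definition G_functor : functor (fblock alpha) (Mod (fHalpha chi)) :=
  block_restr (feO alpha) (cut_functor (fe_idempotent chi)).

End Functors.
End Specialization.

(* Main.v *)
From HB Require Import structures.
Require Import Defs.
From mathcomp Require Import all_boot all_order all_fingroup all_algebra.
From mathcomp Require Import cardinality.
From mathcomp Require Import boolp classical_sets.

(** Write H for the specialized algebra, e for the idempotent of the chosen
character of the orbit alpha, and c for the central idempotent of alpha.
The statement is an instance of Morita theory: as soon as c lies in the
two-sided ideal H e H, say c = sum_i x_i e y_i, and c e = e, the functors
V |-> H e (x)_(eHe) V and M |-> e M are mutually inverse up to natural
isomorphism between the eHe-modules and the H-modules on which c acts as the
identity ([morita_adjoint_equivalence]).  The unit v |-> e (x) v is bijective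
for any idempotent e, with inverse x (x) v |-> (e x) v.  The counit
x (x) m |-> x m is inverted on the block by m |-> sum_i x_i e (x) e y_i m, because
sum_i x_i e y_i = c acts there as the identity.

What is special to the Yokonuma-type algebra is the membership of c in H e H
([eO_ideal]).  It holds over the coefficient ring A, hence after every
specialization.  The quadratic relation and the invertibility of q give R_i a
left inverse y_i ([R_left_inverse]); since e_chi R_i = R_i e_(s_i chi), we get
e_(s_i chi) = y_i e_chi R_i, so membership of e_chi in a two-sided ideal passes
to e_(s_i chi).  As the s_i generate the symmetric group, the ideal generated
by one e_chi contains the idempotents of the whole orbit, and their sum. *)

Set Implicit Arguments.
Unset Strict Implicit.
Unset Printing Implicit Defensive.

Import GRing.Theory.
Local Open Scope ring_scope.

(** * Inverting natural and linear isomorphisms *)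

Section InverseIso.
Variables (C D : category) (F G : functor C D) (eta : nat_trans F G).
Hypothesis eta_iso : is_nat_iso eta.

Let inv X : Defs.Hom (G X) (F X) := sval (cid (eta_iso X)).

Let inv_l X : compm (inv X) (eta X) = Defs.idm (F X).
Proof. exact: (svalP (cid (eta_iso X))).1. Qed.

Let inv_r X : compm (eta X) (inv X) = Defs.idm (G X).
Proof. exact: (svalP (cid (eta_iso X))).2. Qed.

Lemma inv_naturality X Y (f : Defs.Hom X Y) :
  compm (fmap F f) (inv X) = compm (inv Y) (fmap G f).
Proof.
rewrite -[LHS]comp1m -(inv_l Y) -compmA; congr compm.
by rewrite compmA -naturality -compmA inv_r compm1.
Qed.

Definition nat_inv : nat_trans G F := NatTrans inv_naturality.

Lemma nat_inv_iso : is_nat_iso nat_inv.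
Proof. by move=> X; exists (eta X); split; [exact: inv_r | exact: inv_l]. Qed.

End InverseIso.

(** An equivalence is reversed by swapping the functors: the inverse of the
counit serves as unit, and that of the unit as counit. *)
Lemma equivalent_categories_of_adjoint (C D : category)
    (F : functor C D) (G : functor D C) :
  adjoint_equivalence F G -> equivalent_categories D C.
Proof.
move=> [eta [eps [_ eta_iso eps_iso]]].
exists G, F, (nat_inv eps_iso), (nat_inv eta_iso).
by split; exact: nat_inv_iso.
Qed.

Section BijectiveLinear.
Variables (B : pzRingType) (V W : lmodType B) (g : {linear V -> W}) (h : W -> V).
Hypotheses (gK : cancel g h) (hK : cancel h g).

HB.instance Definition _ :=
  GRing.isZmodMorphism.Build W V h (can2_zmod_morphism gK hK).
HB.instance Definition _ :=
  GRing.isScalable.Build B W V *:%R h (can2_scalable gK hK).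

Lemma linear_can2_iso : is_iso (C := Mod B) (g : Defs.Hom (V : Mod B) W).
Proof.
exists (h : {linear W -> V}); split; apply: linear_ext => v.
- exact: gK.
- exact: hK.
Qed.

End BijectiveLinear.

(** * The two-sided ideal of an element *)

(** A product x e y with fixed e absorbs left and right factors, so these sums
form the two-sided ideal B e B. *)
Definition in_ideal (B : pzRingType) (e x : B) : Prop :=
  exists s : seq (B * B), x = \sum_(p <- s) p.1 * e * p.2.

Section Ideal.
Variables (B : pzRingType) (e : B).

Lemma ideal_id : in_ideal e e.
Proof. by exists [:: (1, 1)]; rewrite big_seq1 mul1r mulr1. Qed.

Lemma ideal_sum (I : Type) (r : seq I) (F : I -> B) :
  (forall i, in_ideal e (F i)) -> in_ideal e (\sum_(i <- r) F i).
Proof.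
move=> eF; apply: (big_ind (in_ideal e)) => //.
- by exists [::]; rewrite big_nil.
- by move=> _ _ [s ->] [t ->]; exists (s ++ t); rewrite big_cat.
Qed.

Lemma ideal_mull y x : in_ideal e x -> in_ideal e (y * x).
Proof.
move=> [s ->]; exists [seq (y * p.1, p.2) | p <- s]; rewrite big_map mulr_sumr.
by apply: eq_bigr => p _; rewrite !mulrA.
Qed.

Lemma ideal_mulr y x : in_ideal e x -> in_ideal e (x * y).
Proof.
move=> [s ->]; exists [seq (p.1, p.2 * y) | p <- s]; rewrite big_map mulr_suml.
by apply: eq_bigr => p _; rewrite !mulrA.
Qed.

Lemma ideal_rmorph (B' : pzRingType) (g : {rmorphism B -> B'}) x :
  in_ideal e x -> in_ideal (g e) (g x).
Proof.
move=> [s ->]; exists [seq (g p.1, g p.2) | p <- s]; rewrite big_map rmorph_sum.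
by apply: eq_bigr => p _; rewrite !rmorphM.
Qed.

End Ideal.

(** * Cutting and inducing along an idempotent *)

Section Unit.
Variables (B : pzRingType) (e : idempotent_of B) (V : lmodType (corner e)).

Lemma lid_gen_subproof : (e : B) \in in_Be e.
Proof. by apply/asboolP; exists 1; rewrite mul1r. Qed.

Definition lid_gen : left_ideal e := LeftIdeal lid_gen_subproof.

Lemma unit_map_subproof (v : V) :
  (ipure lid_gen v : induced V) \in in_cut e (V := induced V).
Proof.
apply/asboolP; exists (ipure lid_gen v); rewrite ipureZ; congr ipure.
by apply: val_inj; rewrite /= idemM.
Qed.

Definition unit_map (v : V) : cut e (induced V) := Cut (unit_map_subproof v).

Lemma unit_map_is_zmod_morphism : zmod_morphism unit_map.
Proof.
move=> u v; apply: (addIr (unit_map v)); rewrite subrK; apply: val_inj => /=.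
by rewrite -ipureDr subrK.
Qed.

Lemma unit_map_is_scalable : scalable unit_map.
Proof.
move=> s v; apply: val_inj => /=; rewrite ipureZ -ipure_bal; congr ipure.
by apply: val_inj; rewrite /= corner_fixl ?corner_fixr// corner_valP.
Qed.

HB.instance Definition _ := GRing.isZmodMorphism.Build V (cut e (induced V))
  unit_map unit_map_is_zmod_morphism.
HB.instance Definition _ := GRing.isScalable.Build (corner e) V
  (cut e (induced V)) *:%R unit_map unit_map_is_scalable.

Lemma lid_corner_subproof (x : left_ideal e) :
  (e : B) * lid_val x \in in_corner e.
Proof.
by apply/asboolP; exists (lid_val x); rewrite -mulrA lid_fix ?lid_valP.
Qed.

Definition lid_corner (x : left_ideal e) : corner e :=
  Corner (lid_corner_subproof x).

Definition unit_inv : induced V -> V :=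
  tens_lift (fun x v => lid_corner x *: v).

(** The conditions under which the formula x (x) v |-> (e x) v descends to the
tensor product. *)
Lemma unit_inv_compat :
  [/\ forall x x' (v : V),
        lid_corner (x + x') *: v = lid_corner x *: v + lid_corner x' *: v,
      forall x (v v' : V),
        lid_corner x *: (v + v') = lid_corner x *: v + lid_corner x *: v' &
      forall x s (v : V),
        lid_corner (lid_ract x s) *: v = lid_corner x *: (s *: v)].
Proof.
split=> [x x' v|x v v'|x s v]; last 1 first.
- by rewrite scalerA; congr (_ *: _); apply: val_inj; exact: mulrA.
- by rewrite -scalerDl; congr (_ *: _); apply: val_inj; exact: mulrDr.
- exact: scalerDr.
Qed.

Lemma unit_inv_pure x v : unit_inv (ipure x v) = lid_corner x *: v.
Proof. by have [h1 h2 h3] := unit_inv_compat; exact: tens_lift_pure. Qed.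

Lemma unit_invD y z : unit_inv (y + z) = unit_inv y + unit_inv z.
Proof. by have [h1 h2 h3] := unit_inv_compat; exact: tens_liftD. Qed.

Lemma unit_inv0 : unit_inv 0 = 0.
Proof. by apply: (addrI (unit_inv 0)); rewrite -unit_invD !addr0. Qed.

Lemma unit_mapK : cancel unit_map (fun z => unit_inv (cut_val z)).
Proof.
move=> v; rewrite unit_inv_pure -[RHS]scale1r; congr (_ *: _).
by apply: val_inj; rewrite /= idemM.
Qed.

(** Sliding e x, an element of eBe, across the tensor sign shows that
e (x) (e x) v = e x (x) v. *)
Lemma ipure_unit_inv z :
  ipure lid_gen (unit_inv z) = (e : B) *: (z : induced V).
Proof.
elim/ind_ind: z => [|y z ey ez|x v].
- rewrite unit_inv0 scaler0; apply: (addrI (ipure lid_gen (0 : V))).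
  by rewrite -ipureDr !addr0.
- by rewrite unit_invD ipureDr ey ez scalerDr.
rewrite unit_inv_pure -ipure_bal ipureZ; congr ipure; apply: val_inj => /=.
by rewrite mulrA idemM.
Qed.

Lemma unit_invK : cancel (fun z => unit_inv (cut_val z)) unit_map.
Proof.
move=> z; apply: val_inj => /=.
by rewrite ipure_unit_inv cut_fix // cut_valP.
Qed.

End Unit.

Section Counit.
Variables (B : pzRingType) (e : idempotent_of B) (M : lmodType B).

Definition counit_map : induced (cut e M) -> M :=
  tens_lift (fun x m => lid_val x *: cut_val m).

Lemma counit_compat :
  [/\ forall (x x' : left_ideal e) (m : cut e M), lid_val (x + x') *: cut_val m =
        lid_val x *: cut_val m + lid_val x' *: cut_val m,
      forall (x : left_ideal e) (m m' : cut e M), lid_val x *: cut_val (m + m') =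
        lid_val x *: cut_val m + lid_val x *: cut_val m' &
      forall (x : left_ideal e) s (m : cut e M),
        lid_val (lid_ract x s) *: cut_val m = lid_val x *: cut_val (s *: m)].
Proof.
split=> [x x' m|x m m'|x s m].
- exact: scalerDl.
- exact: scalerDr.
- by rewrite /= scalerA.
Qed.

Lemma counit_pure x m : counit_map (ipure x m) = lid_val x *: cut_val m.
Proof. by have [h1 h2 h3] := counit_compat; exact: tens_lift_pure. Qed.

Lemma counitD y z : counit_map (y + z) = counit_map y + counit_map z.
Proof. by have [h1 h2 h3] := counit_compat; exact: tens_liftD. Qed.

Lemma counit_is_zmod_morphism : zmod_morphism counit_map.
Proof. by move=> y z; apply: (addIr (counit_map z)); rewrite -counitD !subrK. Qed.

HB.instance Definition _ := GRing.isZmodMorphism.Build (induced (cut e M)) M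
  counit_map counit_is_zmod_morphism.

Lemma counit_is_scalable : scalable counit_map.
Proof.
move=> b z; elim/ind_ind: z => [|y z ey ez|x m].
- by rewrite scaler0 raddf0 scaler0.
- by rewrite counitD !scalerDr counitD ey ez.
- by rewrite ipureZ !counit_pure scalerA.
Qed.

HB.instance Definition _ := GRing.isScalable.Build B (induced (cut e M)) M
  *:%R counit_map counit_is_scalable.

End Counit.

(** * The Morita equivalence with a block *)

Section Morita.
Variables (B : pzRingType) (e : idempotent_of B) (c : B).
Hypothesis c_central : forall x, c * x = x * c.
Hypothesis c_e : c * (e : B) = (e : B).
Hypothesis c_full : in_ideal (e : B) c.

(** With c = sum_i x_i e y_i, the element c acts as 1 on each term since it
moves past x_i and c e = e. *)
Lemma central_full_idem : c * c = c.
Proof.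
have [s cE] := c_full; rewrite {2 3}cE mulr_sumr; apply: eq_bigr => p _.
by rewrite !mulrA c_central -[p.1 * c * _]mulrA c_e.
Qed.

(** The block condition c M = M only says that c acts surjectively; being
idempotent, c then acts as the identity. *)
Lemma block_fix (M : lmodType B) : in_block c M -> forall m : M, c *: m = m.
Proof.
move=> cM m; have : ([set: M])%classic m by [].
by rewrite cM => -[m' _ <-]; rewrite scalerA central_full_idem.
Qed.

Section CounitInverse.
Variable M : lmodType B.
Hypothesis cM : in_block c M.

Lemma lid_of_subproof x : x * (e : B) \in in_Be e.
Proof. by apply/asboolP; exists x. Qed.

Lemma cut_of_subproof (m : M) : (e : B) *: m \in in_cut e (V := M).
Proof. by apply/asboolP; exists m. Qed.

(** The candidate inverse m |-> sum_i x_i e (x) e y_i m of the counit.  It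
depends on the chosen decomposition of c only in appearance, being an inverse of
a map that does not. *)
Definition counit_inv (m : M) : induced (cut e M) :=
  \sum_(p <- sval (cid c_full))
    (ipure (LeftIdeal (lid_of_subproof p.1)) (Cut (cut_of_subproof (p.2 *: m)))
      : induced _).

Lemma counit_invK : cancel counit_inv (counit_map (M := M)).
Proof.
move=> m; rewrite raddf_sum -[RHS](block_fix cM).
rewrite [in RHS](svalP (cid c_full)) scaler_suml; apply: eq_bigr => p _.
by rewrite [LHS]counit_pure /= !scalerA -(mulrA p.1) idemM.
Qed.

(** For x in Be and m in eM, each e y_i x lies in eBe and can be moved to the
left of the tensor sign, which leaves (sum_i x_i e y_i) x (x) m = c x (x) m, and
c x = x because x = x e. *)
Lemma counit_inv_pure x m : counit_inv (lid_val x *: cut_val m) = ipure x m.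
Proof.
have xe : lid_val x * (e : B) = lid_val x by apply/lid_fix/lid_valP.
have corner_p (y : B) : (e : B) * (y * lid_val x) \in in_corner e.
  by apply/asboolP; exists (y * lid_val x); rewrite -!mulrA xe.
transitivity (c *: (ipure x m : induced (cut e M))); last first.
  rewrite ipureZ; congr ipure; apply: val_inj => /=.
  by rewrite -xe mulrA c_central -mulrA c_e.
rewrite [in RHS](svalP (cid c_full)) scaler_suml; apply: eq_bigr => p _.
transitivity (ipure (LeftIdeal (lid_of_subproof p.1)) (Corner (corner_p p.2) *: m)).
  by congr ipure; apply: val_inj; rewrite /= !scalerA !mulrA.
rewrite -ipure_bal ipureZ; congr ipure; apply: val_inj => /=.
by rewrite !mulrA -(mulrA p.1) idemM.
Qed.

Lemma counit_mapK : cancel (counit_map (M := M)) counit_inv.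
Proof.
have invD m m' : counit_inv (m + m') = counit_inv m + counit_inv m'.
  rewrite -big_split; apply: eq_bigr => p _ /=; rewrite -ipureDr.
  by congr ipure; apply: val_inj; rewrite /= !scalerDr.
have inv0 : counit_inv 0 = 0.
  by apply: (addrI (counit_inv 0)); rewrite -invD !addr0.
elim/ind_ind => [|y z ey ez|x m]; first by rewrite raddf0.
- by rewrite counitD invD ey ez.
- by rewrite counit_pure counit_inv_pure.
Qed.

End CounitInverse.

Hypothesis ind_block : forall V : Mod (corner e), in_block c (ind_functor e V).

Let F : functor (Mod (corner e)) (block c) := block_functor ind_block.
Let G : functor (block c) (Mod (corner e)) := block_restr c (cut_functor e).

Let eta (V : Mod (corner e)) : Defs.Hom (id_functor _ V) (comp_functor G F V) :=
  (unit_map (V := V) : {linear V -> cut e (induced V)}).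

Lemma unit_natural V W (g : Defs.Hom V W) :
  compm (fmap (comp_functor G F) g) (eta V) = compm (eta W) (fmap (id_functor _) g).
Proof.
apply: linear_ext => v; apply: val_inj => /=.
exact: ind_map_pure.
Qed.

Let eps (M : block c) : Defs.Hom (comp_functor F G M) (id_functor _ M) :=
  (counit_map (M := sval M) : {linear induced (cut e (sval M)) -> sval M}).

Lemma counit_natural M N (g : Defs.Hom M N) :
  compm (fmap (id_functor _) g) (eps M) = compm (eps N) (fmap (comp_functor F G) g).
Proof.
apply: ind_linear_ext => x m.
rewrite /= ind_map_pure !counit_pure /=; exact: linearZ.
Qed.

(** The first triangle identity reduces to x e = x on Be, the second to e m = m
on eM. *)
Lemma morita_adjoint_equivalence : adjoint_equivalence F G.
Proof.
exists (NatTrans unit_natural), (NatTrans counit_natural); split.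
- split=> [V|M].
    apply: ind_linear_ext => x v.
    rewrite /= ind_map_pure counit_pure /= ipureZ; congr ipure.
    by apply: val_inj; rewrite /= lid_fix// lid_valP.
  apply: linear_ext => m; apply: val_inj.
  by rewrite /= counit_pure /= cut_fix// cut_valP.
- move=> V; exact: linear_can2_iso (@unit_mapK _ e V) (@unit_invK _ e V).
- move=> [M cM].
  have [g [gl gr]] := linear_can2_iso (@counit_mapK M) (counit_invK cM).
  by exists g.
Qed.

End Morita.

(** * Fullness of the idempotent of a character *)

(** Conjugation by an adjacent transposition moves one end of a transposition by
one step, the inductive step in generating all transpositions from the adjacent
ones. *)
Lemma tpermS_conj n (i : 'I_n) (j : 'I_n.-1) : i != ord_lo j -> i != ord_hi j ->
  tperm i (ord_hi j) = (s_ j * tperm i (ord_lo j) * s_ j)%g.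
Proof.
move=> il ih; have sV : (s_ j)^-1%g = s_ j by rewrite tpermV.
have -> : (s_ j * tperm i (ord_lo j) * s_ j)%g = (tperm i (ord_lo j) ^ s_ j)%g.
  by rewrite conjgE sV mulgA.
by rewrite tpermJ tpermL tpermD // eq_sym.
Qed.

(** Adjacent transpositions generate the symmetric group, as an induction
principle.  Transpositions (i j) with i < j are reached by induction on the
distance j - i. *)
Lemma perm_adjacent_ind n (P : {perm 'I_n} -> Prop) :
  P 1%g -> (forall s t, P s -> P t -> P (s * t)%g) -> (forall j, P (s_ j)) ->
  forall s, P s.
Proof.
move=> P1 PM Ps.
have Plt d (i j : 'I_n) : (j = i + d.+1 :> nat)%N -> P (tperm i j).
  elim: d j => [|d IH] j ji.
    have jn : (i < n.-1)%N by have := ltn_ord j; rewrite ji addn1 ltn_predRL.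
    rewrite (_ : tperm i j = s_ (Ordinal jn)); first exact: Ps.
    by congr tperm; apply: val_inj => //=; rewrite ji addn1.
  have jn : (i + d.+1 < n.-1)%N by have := ltn_ord j; rewrite ji addnS ltn_predRL.
  have -> : j = ord_hi (Ordinal jn) by apply: val_inj; rewrite /= ji addnS.
  rewrite tpermS_conj; last 2 first.
  - by rewrite -val_eqE /= -[X in X == _]addn0 eqn_add2l.
  - by rewrite -val_eqE /= -addnS -[X in X == _]addn0 eqn_add2l.
  by apply: (PM _ _ (PM _ _ (Ps _) _) (Ps _)); exact: IH.
have Pt (i j : 'I_n) : P (tperm i j).
  have [ij|ji|/val_inj->] := ltngtP i j; last by rewrite tperm1.
  - by apply: (Plt (j - i.+1)%N); rewrite addnS -addSn subnKC.
  - by rewrite tpermC; apply: (Plt (i - j.+1)%N); rewrite addnS -addSn subnKC.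
move=> s; have [ts -> _] := prod_tpermP s.
by apply: (big_ind P) => // t _; exact: Pt.
Qed.

Section Fullness.
Variable S : setting.

Local Notation H := (heckeA S).

(** A is the intersection of the admissible subrings, and each of these contains
an inverse of q, which can only be its inverse in the ambient field. *)
Lemma qA_unit : exists v : coefA S, v * qA S = 1.
Proof.
have q0 : qL S != 0.
  by rewrite /qL fmorph_eq0 tofrac_eq0 polyC_eq0 polyX_eq0.
have vA : (qL S)^-1 \in inA (S := S).
  apply/asboolP => P admP; have [_ [v Pv qv]] := adm_unitq admP.
  by have -> // : (qL S)^-1 = v by apply: (mulfI q0); rewrite qv mulfV.
by exists (CoefA vA); apply: val_inj; rewrite /= mulVf.
Qed.

(** The quadratic relation has the form R_i^2 = q + x R_i, so that
q^-1 (R_i - x) is a left inverse of R_i. *)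
Lemma R_left_inverse (i : 'I_(size_n S).-1) : exists y : H, y * R_ i = 1.
Proof.
pose HZ := heckeZ (order_b S) (size_n S); pose r : HZ := pcl (Gen (inr i)).
have [y ry] : exists y : HZ, r * r = alg_map HZ 'X%:P + y * r.
  eexists; rewrite -pcl_mul.
  transitivity (pcl (Exp (Gen (inr i)) 2) : HZ).
    by rewrite pcl_exp expr2 pcl_mul.
  rewrite (pcl_rel (hecke_quad _ _ _ _)) pcl_add pcl_mul; reflexivity.
pose x := one_tens (evA S) HZ y.
have Rx : R_ i * R_ i = alg_map H (qA S) + x * R_ i.
  have -> : qA S = evA S 'X%:P.
    by rewrite /= map_polyC /= /horner_eval hornerC map_polyX hornerX.
  rewrite -one_tens_map -[R_ i]/(one_tens (evA S) HZ r) -!rmorphM -rmorphD.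
  by rewrite ry.
have [v vq] := qA_unit.
exists (alg_map H v * (R_ i - x)).
by rewrite -mulrA mulrBl Rx addrK -rmorphM vq rmorph1.
Qed.

(** If y R_i = 1, then e_(s_i psi) = y R_i e_(s_i psi) = y e_psi R_i lies in
every two-sided ideal that contains e_psi. *)
Lemma e_ideal_act (chi : XD S) (s : {perm 'I_(size_n S)}) (psi : XD S) :
  in_ideal (e_ chi) (e_ psi) -> in_ideal (e_ chi) (e_ (Defs.actX (W_of s) psi)).
Proof.
move: s psi; apply: perm_adjacent_ind => [psi|s t es et psi|i psi].
- suff -> : Defs.actX (W_of 1) psi = psi by [].
  by apply: XD_ext => d /=; rewrite conjD1.
- move=> /et/es; congr (in_ideal _ (e_ _)); apply: XD_ext => d /=.
  by rewrite conjD_perm.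
have [y yR] := R_left_inverse i.
move=> epsi; rewrite -[X in in_ideal _ X]mul1r -yR -mulrA -e_R.
exact/ideal_mull/ideal_mulr.
Qed.

(** The group W acts transitively on an orbit, so the ideal of one e_chi
contains all summands of the idempotent of the orbit. *)
Lemma eO_ideal (alpha : orbits S) chi :
  sval alpha chi -> in_ideal (e_ chi) (eO_ alpha).
Proof.
move=> achi; rewrite eO_E big_seq_cond big_mkcond /=.
apply: ideal_sum => psi; case: ifP => [|_]; last by exists [::]; rewrite big_nil.
rewrite andbT in_fset_set ?inE; last exact: orbit_finite.
case: alpha achi => _ /= [chi0 ->] [w ->] [w' ->].
have [[s ->] [t ->]] := (WP w, WP w').
have -> : Defs.actX (W_of t) chi0 =
    Defs.actX (W_of (t * s^-1)) (Defs.actX (W_of s) chi0).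
  by apply: XD_ext => d /=; rewrite conjD_perm mulgKV.
exact/e_ideal_act/ideal_id.
Qed.

End Fullness.

Theorem theorem2p11 (S : setting)
    (rep : orbits S -> XD S)
    (rep_in : forall alpha : orbits S, sval alpha (rep alpha))
    (alpha : orbits S)
    (k : comPzRingType) (f : {rmorphism coefA S -> k}) :
  adjoint_equivalence (F_functor f (rep_in alpha)) (G_functor f alpha (rep alpha))
  /\ equivalent_categories (fblock f alpha) (Mod (fHalpha f (rep alpha))).
Proof.
have adj : adjoint_equivalence (F_functor f (rep_in alpha))
    (G_functor f alpha (rep alpha)).
  apply: morita_adjoint_equivalence.
  - exact: feO_central.
  - exact/feO_fe/rep_in.
  - exact/ideal_rmorph/eO_ideal/rep_in.
by split=> //; exact: equivalent_categories_of_adjoint adj.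
Qed.
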